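(* Let $d\ge 2$ and fix $x\in\mathcal X$. Suppose $\preccurlyeq$ is plateau-free and $r_x$-regular at $x$ with regularity radius $r_x>0$ and outward unit normal $n_x$, and assume moreover that $\mathcal S_x$ is convex. Fix $\epsilon\in(0,\sqrt2]$ and set $$T_\epsilon:=\left\lceil\log_2\left(\frac{\pi\sqrt{d-1}}{2\epsilon}\right)\right\rceil .$$ Run the adaptive-radius normal estimation algorithm $\mathrm{ANE}(x,T_\epsilon)$ with the shared comparison radius initialized to $h_0>0$. Then the algorithm terminates almost surely and returns $\widehat n$ satisfying $\|\widehat n-n_x\|\le\epsilon$. Moreover, for every $\delta\in(0,1)$, with probability at least $1-\delta$ the number $N_\epsilon$ of pairwise comparisons used satisfies $$N_\epsilon\le 2(d-1)\left\lceil\log_2\left(\frac{7\sqrt{d-1}}{\epsilon}\right)\right\rceil+2\left\lceil\log_2\left(\frac{h_0d^3}{r_x\epsilon}\right)\right\rceil_++16+4\left\lceil\log_2\left(\frac1\delta\right)\right\rceil .$$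
   Context: Notation: $\lceil t\rceil_+=\max\{\lceil t\rceil,0\}$. Setting. $(\mathcal X,\langle\cdot,\cdot\rangle)$ is a $d$-dimensional real Euclidean space with norm $\|\cdot\|$, unit sphere $\mathbb S^{d-1}$ and closed balls $B(z,r)$. $\preccurlyeq$ is a complete and transitive binary relation on $\mathcal X$ (''$x\preccurlyeq y$'': $x$ is no worse than $y$); $x\prec y$ means $x\preccurlyeq y$ and not $y\preccurlyeq x$; $x\sim y$ means $x\preccurlyeq y$ and $y\preccurlyeq x$. For a feasible set $\mathcal C\subseteq\mathcal X$, $\mathcal X^\star=\{x\in\mathcal C: x\preccurlyeq y\ \forall y\in\mathcal C\}$. $\mathcal S_x=\{y\in\mathcal X:y\preccurlyeq x\}$, $\mathcal L_x=\{y\in\mathcal X:y\sim x\}$. $\preccurlyeq$ is plateau-free if $\partial\mathcal S_x=\mathcal L_x$ for every $x\in\mathcal X\setminus\mathcal X^\star$. Regularity. For $x\in\partial\mathcal S_x$ and $r\ge 0$, $\preccurlyeq$ is $r$-regular at $x$ if there is $n\in\mathbb S^{d-1}$ with $B(x-rn,r)\subseteq\mathcal S_x$ and $B(x+rn,r)\subseteq\overline{\mathcal X\setminus\mathcal S_x}$. When $r>0$ the vector $n$ is the unique outward unit normal to $\partial\mathcal S_x$ at $x$, denoted $n_x$, and the regularity radius is $r_x=\sup\{r\ge0:B(x-rn_x,r)\subseteq\mathcal S_x\text{ and }B(x+rn_x,r)\subseteq\overline{\mathcal X\setminus\mathcal S_x}\}\in(0,\infty]$. A (pairwise) comparison of two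 points $p,q$ reveals which of $p\prec q$, $p\sim q$, $q\prec p$ holds. A single radius variable $h$ is shared by all routines below; it is initialized once (to $h_0$) and only changed by LineSearch. $\mathrm{LineSearch}(x,u)$, $u\in\mathbb S^{d-1}$: while $x\prec x+hu$ and $x\prec x-hu$, replace $h$ by $h/2$. (Each check of the while-condition costs two comparisons; the outcomes of the comparisons of $x$ with $x\pm hu$ at the final $h$ are read off from the last check, without additional comparisons.) $\mathrm{APlanar}(x,a,b,T)$ ($a,b$ orthonormal). (1) Draw $\theta$ uniform on $[0,2\pi)$; set $\bar a=\cos\theta\,a+\sin\theta\,b$, $\bar b=-\sin\theta\,a+\cos\theta\,b$. (2) Call $\mathrm{LineSearch}(x,\bar a)$ and compare $x$ with $x+h\bar a$ and $x-h\bar a$. If ($x+h\bar a\preccurlyeq x$ and $x-h\bar a\preccurlyeq x$) or ($x\preccurlyeq x+h\bar a$ and $x\preccurlyeq x-h\bar a$), return $\bar a$. (3) If $x+h\bar a\preccurlyeq x$ set $(u_+,u_-)=(-\bar a,\bar a)$, else $(u_+,u_-)=(\bar a,-\bar a)$. (4) Call $\mathrm{LineSearch}(x,\bar b)$ and compare $x$ with $x+h\bar b$; if $x+h\bar b\preccurlyeq x$ set $u_-=\bar b$, else $u_+=\bar b$. (5) For $t=1,\dots,T$: set $u_M=(u_++u_-)/\|u_++u_-\|$, call $\mathrm{LineSearch}(x,u_M)$ and compare $x$ with $x+hu_M$; if $x+hu_M\preccurlyeq x$ set $u_-=u_M$, else $u_+=u_M$. (6) Return the last computed $u_M$. $\mathrm{ANE}(x,T)$.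 Draw a Haar-uniform orthonormal frame $(q_1,\dots,q_d)$ of $\mathcal X$; set $v_1=q_1$. For $i=1,\dots,d-1$: let $y_i=\mathrm{APlanar}(x,v_i,q_{i+1},T)$ and $v_{i+1}=-\langle y_i,q_{i+1}\rangle v_i+\langle y_i,v_i\rangle q_{i+1}$. Finally call $\mathrm{LineSearch}(x,v_d)$ and compare $x$ with $x+hv_d$; return $\widehat n=-v_d$ if $x+hv_d\prec x$, and $\widehat n=v_d$ otherwise.
   Formalization: The bound on the error of n̂ is proved only if, for each k, x+(h_0/2^k)u ∼ x for almost no direction u (it fails for a half disc); and ∂S_x = L_x is assumed at x itself, which plateau-freeness gives only when x is not in X*. *)

(* Defs.v *)
From HB Require Import structures.
From mathcomp Require Import all_boot all_order all_algebra.
From mathcomp Require Import all_classical all_reals all_analysis.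
Set Implicit Arguments.
Unset Strict Implicit.
Unset Printing Implicit Defensive.
Import Order.TTheory GRing.Theory Num.Theory.
Import numFieldNormedType.Exports.

Local Open Scope classical_set_scope.
Local Open Scope ring_scope.

(* The Euclidean space is the space of row vectors 'rV[R]_d.  The norm `|_| of
   the library on 'rV[R]_d is the sup norm, so the Euclidean one is defined
   here; both give the same topology, hence the same closure and interior. *)
Definition dot (R : realType) (d : nat) (u v : 'rV[R]_d) : R :=
  \sum_(i < d) u 0 i * v 0 i.

Definition enorm (R : realType) (d : nat) (u : 'rV[R]_d) : R :=
  Num.sqrt (dot u u).

Definition cball (R : realType) (d : nat) (z : 'rV[R]_d) (r : R) :
    set 'rV[R]_d :=
  [set y | enorm (y - z) <= r].

Definition boundary (T : topologicalType) (A : set T) : set T :=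
  closure A `\` interior A.

(* [le y z] reads "y is no worse than z". *)
Definition prec (T : Type) (le : rel T) : rel T :=
  fun y z => le y z && ~~ le z y.

Definition indiff (T : Type) (le : rel T) : rel T :=
  fun y z => le y z && le z y.

Definition sublevel (T : Type) (le : rel T) (x : T) : set T :=
  [set y | le y x].

Definition levelset (T : Type) (le : rel T) (x : T) : set T :=
  [set y | indiff le y x].

Definition optimal (T : Type) (le : rel T) (C : set T) : set T :=
  [set x | C x /\ forall y, C y -> le x y].

Definition plateau_free_at (T : topologicalType) (le : rel T) (x : T) : Prop :=
  boundary (sublevel le x) = levelset le x.

Definition plateau_free (T : topologicalType) (le : rel T) (C : set T) : Prop :=
  forall x, ~ optimal le C x -> plateau_free_at le x.

(* r-regularity at x, witnessed by the unit vector n. *)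
Definition regular_with (R : realType) (d : nat) (le : rel 'rV[R]_d)
    (x : 'rV[R]_d) (r : R) (n : 'rV[R]_d) : Prop :=
  [/\ boundary (sublevel le x) x, 0 <= r, enorm n = 1,
      cball (x - r *: n) r `<=` sublevel le x
    & cball (x + r *: n) r `<=` closure (~` sublevel le x)].

(* Regularity for a radius that may be +oo. For a finite radius s >= 0 it is
   the same as [regular_with le x s n], since the balls increase with r. *)
Definition eregular_with (R : realType) (d : nat) (le : rel 'rV[R]_d)
    (x : 'rV[R]_d) (s : \bar R) (n : 'rV[R]_d) : Prop :=
  forall r : R, 0 <= r -> (r%:E <= s)%E -> regular_with le x r n.

Definition regularity_radius (R : realType) (d : nat) (le : rel 'rV[R]_d)
    (x n : 'rV[R]_d) : \bar R :=
  ereal_sup [set r%:E | r in [set r : R | regular_with le x r n]].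

(* A computation maps the current value of the shared radius to its result,
   the new value of the radius and the number of comparisons spent; [None] is
   nontermination. *)
Definition comp (R A : Type) : Type := R -> option (A * R * nat).

Definition cret (R A : Type) (a : A) : comp R A := fun h => Some (a, h, 0%N).

Definition cbind (R A B : Type) (m : comp R A) (f : A -> comp R B) :
    comp R B :=
  fun h =>
    if m h is Some (a, h1, N1) then
      if f a h1 is Some (b, h2, N2) then Some (b, h2, (N1 + N2)%N) else None
    else None.

Declare Scope comp_scope.
Delimit Scope comp_scope with comp.
Notation "a <- m ;; k" := (cbind m (fun a => k))
  (at level 61, m at next level, right associativity) : comp_scope.
Local Open Scope comp_scope.

(* The loop stops after k halvings, k being the first index for which the test
   fails; the test has then been evaluated k + 1 times.  The result is the
   final radius.  Callers read the comparisons of x with x + h u and x - h u at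
   that radius off the last test, so they do not pay for them. *)
Definition line_search (R : realType) (d : nat) (le : rel 'rV[R]_d)
    (x u : 'rV[R]_d) : comp R R :=
  fun h =>
    let test k := prec le x (x + (h / 2 ^+ k) *: u)
               && prec le x (x - (h / 2 ^+ k) *: u) in
    match pselect (exists k, ~~ test k) with
    | left e => let k := ex_minn e in
                Some (h / 2 ^+ k, h / 2 ^+ k, (2 * k.+1)%N)
    | right _ => None
    end.

(* [last] is the last computed midpoint; its initial value is only returned
   when T = 0. *)
Fixpoint bisection (R : realType) (d : nat) (le : rel 'rV[R]_d)
    (x : 'rV[R]_d) (T : nat) (up um last : 'rV[R]_d) {struct T} :
    comp R 'rV[R]_d :=
  if T is T'.+1 then
    let uM := (enorm (up + um))^-1 *: (up + um) in
    h <- line_search le x uM ;;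
    if le (x + h *: uM) x then bisection le x T' up uM uM
    else bisection le x T' uM um uM
  else cret last.

Definition aplanar (R : realType) (d : nat) (le : rel 'rV[R]_d)
    (x a b : 'rV[R]_d) (T : nat) (theta : R) : comp R 'rV[R]_d :=
  let abar := cos theta *: a + sin theta *: b in
  let bbar := - sin theta *: a + cos theta *: b in
  h <- line_search le x abar ;;
  let p := x + h *: abar in
  let m := x - h *: abar in
  if (le p x && le m x) || (le x p && le x m) then cret abar else
  let up := if le p x then - abar else abar in
  let um := if le p x then abar else - abar in
  h' <- line_search le x bbar ;;
  if le (x + h' *: bbar) x then bisection le x T up bbar abar
  else bisection le x T bbar um abar.

(* The dimension is d = n + 1.  The rows of Q are the frame q_1, ..., q_d, so
   that q_1 is row 0, and [lift ord0 i] is the index i + 1. *)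
Fixpoint ane_loop (R : realType) (n : nat) (le : rel 'rV[R]_n.+1)
    (x : 'rV[R]_n.+1) (T : nat) (Q : 'M[R]_n.+1) (theta : 'I_n -> R)
    (s : seq 'I_n) (v : 'rV[R]_n.+1) {struct s} : comp R 'rV[R]_n.+1 :=
  if s is i :: s' then
    let q := row (lift ord0 i) Q in
    y <- aplanar le x v q T (theta i) ;;
    ane_loop le x T Q theta s' (- dot y q *: v + dot y v *: q)
  else cret v.

Definition ane (R : realType) (n : nat) (le : rel 'rV[R]_n.+1)
    (x : 'rV[R]_n.+1) (T : nat) (Q : 'M[R]_n.+1) (theta : 'I_n -> R) :
    comp R 'rV[R]_n.+1 :=
  v <- ane_loop le x T Q theta (enum 'I_n) (row ord0 Q) ;;
  h <- line_search le x v ;;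
  cret (if prec le (x + h *: v) x then - v else v).

(* 'M[R]_d with its Borel sigma-algebra. *)
Notation borel_mx R d := (g_sigma_algebraType (@open 'M[R]_d)).

Definition orthogonal_mx (R : realType) (d : nat) (A : 'M[R]_d) : Prop :=
  A *m A^T = 1%:M.

(* Haar-uniformity: the law of the frame is invariant under every linear
   isometry v |-> v *m A of the space. *)
Definition haar_frame (R : realType) (d : nat) (disp : measure_display)
    (Omega : measurableType disp) (P : probability Omega R)
    (Q : {RV P >-> borel_mx R d}) : Prop :=
  (forall w, orthogonal_mx (Q w : 'M[R]_d)) /\
  forall (A : 'M[R]_d), orthogonal_mx A ->
  forall B : set (borel_mx R d), measurable B ->
    distribution P Q [set M : 'M[R]_d | B (M *m A)] = distribution P Q B.

Definition uniform_angle (R : realType) (disp : measure_display)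
    (Omega : measurableType disp) (P : probability Omega R)
    (theta : {RV P >-> R}) : Prop :=
  forall B : set R, measurable B ->
    distribution P theta B =
    (((2 * pi)^-1)%:E * lebesgue_measure (B `&` `[0%R, (2 * pi)%R[))%E.

(* Mutual independence of the frame and of all the angles; subfamilies are
   covered by taking some of the sets to be full. *)
Definition independent_draws (R : realType) (n d : nat) (disp : measure_display)
    (Omega : measurableType disp) (P : probability Omega R)
    (Q : {RV P >-> borel_mx R d}) (theta : 'I_n -> {RV P >-> R}) : Prop :=
  forall (B : set (borel_mx R d)) (A : 'I_n -> set R),
    measurable B -> (forall i, measurable (A i)) ->
    P ((Q @^-1` B) `&` [set w | forall i, A i (theta i w)]) =
    (P (Q @^-1` B) * \prod_(i < n) P (theta i @^-1` A i))%E.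

(* For every radius h0 / 2^k that the algorithm can use, almost no direction u
   makes x + (h0 / 2^k) u indifferent to x (q_1 is a uniform direction).
   This fails only if L_x contains a non-negligible part of a sphere centred
   at x of such a radius.  It cannot be dropped from the accuracy claim: if S_x
   is the half disc {|y| <= 1, y_2 <= 0} in the plane, x = 0 and h0 = 1, then
   the early exit of [aplanar] is taken on a tie with the arc for almost every
   abar, and the returned direction is that random abar. *)
Definition ties_negligible (R : realType) (n : nat) (disp : measure_display)
    (Omega : measurableType disp) (P : probability Omega R)
    (le : rel 'rV[R]_n.+1) (x : 'rV[R]_n.+1) (h0 : R)
    (Q : {RV P >-> borel_mx R n.+1}) : Prop :=
  {ae P, forall w, forall k : nat,
    ~~ indiff le (x + (h0 / 2 ^+ k) *: row ord0 (Q w : 'M[R]_n.+1)) x}.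

Definition log2 (R : realType) (t : R) : R := ln t / ln 2.

Definition ceil_plus (R : realType) (t : R) : int := Num.max (Num.ceil t) 0.

(* The number T_eps for d = n + 1; the ceiling is positive when n >= 1 and
   0 < eps <= sqrt 2, so that the absolute value has no effect. *)
Definition steps (R : realType) (n : nat) (eps : R) : nat :=
  `|Num.ceil (log2 (pi * Num.sqrt n%:R / (2 * eps)))|%N.

(* ceil_+ (log2 (h0 d^3 / (rx eps))), which is 0 when rx is infinite. *)
Definition radius_term (R : realType) (d : nat) (h0 : R) (rx : \bar R)
    (eps : R) : int :=
  if rx is r%:E then ceil_plus (log2 (h0 * d%:R ^+ 3 / (r * eps))) else 0.

(* Main.v *)
(* For a convex sublevel set with an interior tangent ball, the sublevel set
   lies in the half-space [<y - x, nx> <= 0], so once a line search along [u]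
   stops it reveals the sign of [<u, nx>], and it stops as soon as the radius is
   at most [2 r |<u, nx>|]. Hence everything is controlled by the smallest value
   [t] of [|<u, nx>|] over the queried directions, which lie, in the plane of
   index [i], at angles [theta_i + m pi / 2^(T+1)].
   Given all draws but [theta_i], such a value is below [t] with probability
   [O(t / |<q_(i+1), nx>|)], by independence and Fubini. As the law of
   [q_(i+1)] is invariant under rotations, [|<q_(i+1), nx>| < s] has probability
   at most [s d]; summing over dyadic levels of [|<q_(i+1), nx>|] and over all
   planes gives [t >= eps delta^2 / (256 d^3)] with probability [1 - delta].
   Accuracy: when there is no tie, each plane rotates [v_i] to within
   [pi / 2^(T+1)] of the projection of [nx], so that
   [|<v_d, nx>| >= cos (pi / 2^(T+1)) ^ (d - 1)]. Ties have probability 0 because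
   for fixed angles the tested directions are unit vectors times the frame,
   which are all distributed as [q_1], the Haar law being also left-invariant. *)

Require Import Defs.
From HB Require Import structures.
From mathcomp Require Import all_boot all_order all_algebra.
From mathcomp Require Import all_classical all_reals all_analysis.
From mathcomp Require Import measurable_realfun.
From mathcomp Require Import ring lra zify.
Import Order.TTheory GRing.Theory Num.Theory.
Import numFieldNormedType.Exports.
Local Open Scope classical_set_scope.
Local Open Scope ring_scope.
Set Implicit Arguments.
Unset Strict Implicit.

(** * Euclidean geometry of row vectors *)

(** The obstacle is adaptivity. The direction entering plane [i] is the outcome of comparisons and
    has no usable law, but it is a function of the frame and of the earlier angles. The conditional
    bound therefore requires this direction to be measurable for the sigma-algebra of all draws but
    [theta i], which is why every subroutine is shown measurable. For ties the roles are exchanged: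
    the directions are replaced by countably many candidates whose coordinates depend on the angles
    alone, so that each is independent of the frame. Origin of the threshold: a plane has [2 ^ T.+1]
    grid angles up to sign, about [sqrt d / eps], and each dyadic level contributes [O(t d)] per
    angle. Over [d - 1] planes this asks for [t] of order [eps delta / d^(5/2)] divided by the
    number of levels, which is logarithmic in [d / delta]; passing to [delta^2] and [d^3] pays for
    that logarithm. The factor [256 = 2^8] costs 7 halvings, the inequality on powers of 2 being
    strict. *)

Section euclidean.
Variables (R : realType) (d : nat).
Implicit Types u v w : 'rV[R]_d.

Lemma dotE u v : dot u v = (u *m v^T) 0 0.
Proof. by rewrite mxE; apply: eq_bigr => i _; rewrite mxE. Qed.

Lemma dotC u v : dot u v = dot v u.
Proof. by apply: eq_bigr => i _; rewrite mulrC. Qed.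

Lemma dotDl u v w : dot (u + v) w = dot u w + dot v w.
Proof. by rewrite !dotE mulmxDl mxE. Qed.

Lemma dotZl k u v : dot (k *: u) v = k * dot u v.
Proof. by rewrite !dotE -scalemxAl mxE. Qed.

Lemma dotNl u v : dot (- u) v = - dot u v.
Proof. by rewrite -scaleN1r dotZl mulN1r. Qed.

Lemma dotBl u v w : dot (u - v) w = dot u w - dot v w.
Proof. by rewrite dotDl dotNl. Qed.

Lemma dotDr u v w : dot w (u + v) = dot w u + dot w v.
Proof. by rewrite dotC dotDl !(dotC w). Qed.

Lemma dotZr k u v : dot v (k *: u) = k * dot v u.
Proof. by rewrite dotC dotZl (dotC v). Qed.

Lemma dotNr u v : dot v (- u) = - dot v u.
Proof. by rewrite dotC dotNl (dotC v). Qed.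

Lemma dotBr u v w : dot w (u - v) = dot w u - dot w v.
Proof. by rewrite dotDr dotNr. Qed.

Definition dot_lin := (dotDl, dotBl, dotZl, dotNl, dotDr, dotBr, dotZr, dotNr).

Lemma dot_ge0 u : 0 <= dot u u.
Proof. by apply: sumr_ge0 => i _; rewrite -expr2 sqr_ge0. Qed.

Lemma dot_eq0 u : dot u u = 0 -> u = 0.
Proof.
move=> /eqP; rewrite psumr_eq0; last by move=> i _; rewrite -expr2 sqr_ge0.
move=> /allP u0; apply/rowP => i; rewrite mxE; apply/eqP.
by have := u0 i (mem_index_enum _); rewrite /= -expr2 sqrf_eq0.
Qed.

Lemma enorm_sqr u : enorm u ^+ 2 = dot u u.
Proof. by rewrite sqr_sqrtr// dot_ge0. Qed.

Lemma enorm_ge0 u : 0 <= enorm u.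
Proof. exact: sqrtr_ge0. Qed.

Lemma enorm1 u : enorm u = 1 <-> dot u u = 1.
Proof.
by rewrite -enorm_sqr; split => [->|/eqP]; rewrite ?expr1n// sqrp_eq1 ?enorm_ge0// => /eqP.
Qed.

Lemma enorm_le u r : 0 <= r -> (enorm u <= r) = (dot u u <= r ^+ 2).
Proof. by move=> r0; rewrite -enorm_sqr ler_sqr// nnegrE enorm_ge0. Qed.

Lemma orthogonal_mx_tr (A : 'M[R]_d) : orthogonal_mx A -> orthogonal_mx A^T.
Proof. by move=> /mulmx1C; rewrite /orthogonal_mx trmxK. Qed.

Lemma orthogonal_mx_mul (A B : 'M[R]_d) :
  orthogonal_mx A -> orthogonal_mx B -> orthogonal_mx (A *m B).
Proof.
by move=> oA oB; rewrite /orthogonal_mx trmx_mul mulmxA -(mulmxA A) oB mulmx1.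
Qed.

Lemma dot_mulmx (A : 'M[R]_d) u v :
  orthogonal_mx A -> dot (u *m A) (v *m A) = dot u v.
Proof. by move=> oA; rewrite !dotE trmx_mul mulmxA -(mulmxA u) oA mulmx1. Qed.

Lemma dot_mulmxr (A : 'M[R]_d) u v : dot (u *m A) v = dot u (v *m A^T).
Proof. by rewrite !dotE trmx_mul trmxK mulmxA. Qed.

Lemma dot_delta (i : 'I_d) u : dot (delta_mx 0 i) u = u 0 i.
Proof.
rewrite /dot (bigD1 i)//= !mxE !eqxx mul1r big1 ?addr0// => j ji.
by rewrite mxE (negbTE ji) andbF mul0r.
Qed.

Lemma dot_row (A : 'M[R]_d) (i j : 'I_d) :
  orthogonal_mx A -> dot (row i A) (row j A) = (i == j)%:R.
Proof.
by move=> oA; rewrite !rowE dot_mulmx// dot_delta mxE eqxx eq_sym; case: eqP.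
Qed.

Lemma parseval (A : 'M[R]_d) u :
  orthogonal_mx A -> \sum_(i < d) dot (row i A) u ^+ 2 = dot u u.
Proof.
move=> /orthogonal_mx_tr oA; rewrite -(dot_mulmx u u oA); apply: eq_bigr => i _.
by rewrite rowE dot_mulmxr dot_delta expr2.
Qed.

Lemma dot_row_le1 (A : 'M[R]_d) i u :
  orthogonal_mx A -> dot u u = 1 -> `|dot (row i A) u| <= 1.
Proof.
move=> oA u1; rewrite -(@expr_le1 _ 2)// real_normK ?num_real//.
rewrite -[leRHS]u1 -(parseval u oA) (bigD1 i)//= lerDl sumr_ge0// => j _.
exact: sqr_ge0.
Qed.

(* The Householder reflection exchanging [u] and [v]. *)
Lemma exists_orthogonal_mx u v : dot u u = 1 -> dot v v = 1 ->
  exists2 A : 'M[R]_d, orthogonal_mx A & u *m A = v.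
Proof.
move=> u1 v1; set w := u - v; set c := dot w w.
have [w0|wn0] := eqVneq w 0.
  exists 1%:M; first by rewrite /orthogonal_mx trmx1 mulmx1.
  by rewrite mulmx1; apply/eqP; rewrite -subr_eq0 -/w w0.
have c0 : c != 0 by apply: contra_neq wn0 => /dot_eq0.
have ww : w *m w^T = c%:M by rewrite (mx11_scalar (w *m w^T)) -dotE.
(* Since [u] and [v] are unit, [dot u w = c / 2], so that [1 - (2 / c) *: p] sends [u] to
   [u - w = v]. *)
have [p [pC pp up]] : exists p : 'M[R]_d,
    [/\ forall i j, p i j = p j i, p *m p = c *: p & u *m p = (c / 2) *: w].
  exists (w^T *m w); split.
  - move=> i j; rewrite -[in LHS](trmxK (w^T *m w)) mxE.
    by congr (fun_of_matrix _ _ _); rewrite trmx_mul trmxK.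
  - by rewrite mulmxA -(mulmxA w^T) ww mul_mx_scalar -scalemxAl.
  - rewrite mulmxA [u *m w^T]mx11_scalar -dotE mul_scalar_mx.
    by congr (_ *: _); rewrite /c /w !dot_lin u1 v1 (dotC v); field.
exists (1%:M - (2 / c) *: p).
  have -> : orthogonal_mx (1%:M - (2 / c) *: p) =
      ((1%:M - (2 / c) *: p) *m (1%:M - (2 / c) *: p) = 1%:M).
    congr (_ *m _ = _); apply/matrixP => i j; rewrite !mxE eq_sym.
    by rewrite pC.
  rewrite mulmxBl mulmxBr mulmx1 mul1mx -scalemxAl mulmxBr mulmx1 -scalemxAr pp.
  apply/matrixP => i j; rewrite !mxE.
  by move: (p i j) (_ == _) => y b; field.
rewrite mulmxBr mulmx1 -scalemxAr up scalerA.
rewrite (_ : 2 / c * (c / 2) = 1); last by field.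
by rewrite scale1r /w opprB addrC subrK.
Qed.

End euclidean.

(** * Convex sublevel sets with a tangent ball *)

Section geometry.
Variables (R : realType) (d : nat) (le : rel 'rV[R]_d) (x nx : 'rV[R]_d).
Hypothesis le_complete : total le.
Hypothesis hpfx : plateau_free_at le x.
Hypothesis hconv :
  convex_set (sublevel le x : set (convex_lmodType 'rV[R]_d)).

Lemma prec_total y : prec le x y = ~~ le y x.
Proof.
by rewrite /prec; have := le_complete x y; case: (le x y); case: (le y x).
Qed.

(** A point of the closure that is not interior is on the boundary, which plateau-freeness
    identifies with [levelset le x]. *)
Lemma sublevel_closed : closed (sublevel le x).
Proof.
move=> y cy; have [yi|yi] := pselect ((sublevel le x)^° y).
  exact: interior_subset yi.
have : boundary (sublevel le x) y by split.
by rewrite hpfx => /andP[].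
Qed.

(** The boundary is the whole level set, so no indifferent point is interior. With
    [sublevel_closed], the two outcomes of a comparison become membership in a closed set and in an
    open set, which makes comparisons measurable. *)
Lemma le_interior y : le x y = ~~ `[< (sublevel le x)^° y >].
Proof.
apply/idP/idP => [xy|].
  apply/negP => /asboolP yi.
  have : levelset le x y by apply/andP; split => //; exact: interior_subset yi.
  by rewrite -hpfx => -[].
apply: contraNT => xy; apply/asboolP.
have yx : le y x by have := le_complete x y; rewrite (negbTE xy).
apply: contrapT => yi.
have : boundary (sublevel le x) y by split => //; exact: subset_closure.
by rewrite hpfx => /andP[_]; rewrite (negbTE xy).
Qed.

Lemma sublevel_conv (y z : 'rV[R]_d) (k : R) : 0 <= k -> k <= 1 ->
  le y x -> le z x -> le (k *: y + (1 - k) *: z) x.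
Proof.
move=> k0 k1 yx zx.
have /(_ (Itv01 k0 k1)) := @hconv y z; rewrite /sublevel !inE.
by move=> /(_ yx zx).
Qed.

Lemma dot_cvg (T : Type) (F : set_system T) (f : T -> 'rV[R]_d) (l : 'rV[R]_d) :
  Filter F ->
  (forall i, f t 0 i @[t --> F] --> l 0 i) ->
  dot (f t) (f t) @[t --> F] --> dot l l.
Proof.
move=> FF fl; apply: cvg_big => [|i _]; last exact: cvgM.
by apply: add_continuous.
Qed.

(* If [x + u] were in the sublevel set with [0 < dot u nx], then [x] would be
   interior to the convex hull of [x + u] and of the tangent ball. *)
Lemma not_le_outward (r : R) (u : 'rV[R]_d) : 0 < r -> regular_with le x r nx ->
  0 < dot u nx -> ~~ le (x + u) x.
Proof.
move=> r0 [[_ xi] _ n1 ball_in _] c0; apply/negP => lexu; apply: xi.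
move/enorm1 in n1.
set c := dot u nx in c0; have u0 : 0 < dot u u.
  rewrite lt_neqAle dot_ge0 andbT eq_sym; apply: contraL c0 => /eqP/dot_eq0.
  by rewrite /c => ->; rewrite /dot big1 ?ltxx// => i _; rewrite mxE mul0r.
(* This [l] minimises the norm of [- l *: u + r *: nx], so that [x - l *: u] lies strictly inside
   the tangent ball. *)
pose l := r * c / dot u u.
have l0 : 0 < l by rewrite divr_gt0// mulr_gt0.
have lu : l * dot u u = r * c by rewrite mulfVK// gt_eqF.
have key : dot (- l *: u + r *: nx) (- l *: u + r *: nx) < r ^+ 2.
  rewrite !dot_lin (dotC nx) n1 -/c.
  have : 0 < l * (r * c) by apply: mulr_gt0 => //; apply: mulr_gt0.
  nra.
(* [x - r *: nx + G p] is the image of [p] under the homothety of centre [x + u] that sends [x] to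
   [x - l *: u]; hence [p] lies between that image and [x + u]. *)
pose G (p : 'rV[R]_d) := - l *: u + r *: nx + (1 + l) *: (p - x).
have : \forall p \near x, dot (G p) (G p) < r ^+ 2.
  have cG : dot (G p) (G p) @[p --> x] --> dot (- l *: u + r *: nx) (- l *: u + r *: nx).
    apply: (@dot_cvg _ (nbhs x)) => i.
    rewrite (_ : (fun t => _) = (fun p : 'rV[R]_d =>
       (- l *: u + r *: nx) 0 i + (1 + l) * (p 0 i - x 0 i))); last first.
      by apply/funext => p; rewrite !mxE.
    rewrite -[X in _ --> X]addr0; apply: cvgD; first exact: cvg_cst.
    rewrite -(mulr0 (1 + l)); apply: cvgM; first exact: cvg_cst.
    rewrite -(subrr (x 0 i)); apply: cvgB; last exact: cvg_cst.
    exact: coord_continuous.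
  by move/cvgr_lt: cG => /(_ _ key).
rewrite /interior /= => near_x; rewrite /nbhs/=.
apply: filterS near_x => p Gp.
have l1 : 0 < 1 + l by rewrite addr_gt0.
have qS : le (x - r *: nx + G p) x.
  apply: ball_in; rewrite /cball /= addrAC subrr add0r enorm_le ?ltW//.
rewrite /sublevel /=.
have -> : p = (1 + l)^-1 *: (x - r *: nx + G p) + (1 - (1 + l)^-1) *: (x + u).
  rewrite /G; apply/rowP => i; rewrite !mxE.
  field; lra.
apply: sublevel_conv => //; first by rewrite invr_ge0 ltW.
by rewrite invf_le1// lerDl ltW.
Qed.

(** The hypothesis is [enorm (u + r *: nx) <= r] squared and expanded: [x + u] is in the inner
    tangent ball. *)
Lemma le_inward (r : R) (u : 'rV[R]_d) : regular_with le x r nx ->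
  dot u u + 2 * r * dot u nx <= 0 -> le (x + u) x.
Proof.
move=> [_ r0 /enorm1 n1 ball_in _] ur; apply: ball_in.
rewrite /cball /= enorm_le//.
rewrite (_ : x + u - _ = u + r *: nx); last by apply/rowP => i; rewrite !mxE; ring.
rewrite !dot_lin n1 (dotC nx).
move: ur; set A := dot u u; set B := dot u nx; nra.
Qed.

End geometry.

(** * The planar search *)

Definition dir (R : realType) (d : nat) (v q : 'rV[R]_d) (phi : R) : 'rV[R]_d :=
  cos phi *: v + sin phi *: q.

Section dir_theory.
Variables (R : realType) (d : nat).
Implicit Types (v q u : 'rV[R]_d) (a b c : R).

Lemma dot_dir v q u a : dot (dir v q a) u = cos a * dot v u + sin a * dot q u.
Proof. by rewrite /dir !dot_lin. Qed.

Lemma dir_pihalf v q a : dir v q (a + pi / 2) = - sin a *: v + cos a *: q.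
Proof. by rewrite /dir cosDpihalf sinDpihalf. Qed.

Lemma dirDpi v q a : dir v q (a + pi) = - dir v q a.
Proof. by rewrite /dir cosDpi sinDpi !scaleNr opprD. Qed.

Lemma dot_dir_dir v q a : dot v v = 1 -> dot q q = 1 -> dot v q = 0 ->
  dot (dir v q a) (dir v q a) = 1.
Proof.
move=> v1 q1 vq; rewrite /dir !dot_lin (dotC q v) v1 q1 vq.
rewrite -[RHS](cos2Dsin2 a); ring.
Qed.

Lemma dir_mid v q a c :
  dir v q (a + c) + dir v q (a - c) = (2 * cos c) *: dir v q a.
Proof.
by apply/rowP => i; rewrite !mxE cosB sinB cosD sinD; ring.
Qed.

(** By [dir_mid] the sum is a positive multiple of the bisecting direction, so the midpoints of
    [bisection] halve angles exactly. *)
Lemma normalize_mid v q a c :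
  dot v v = 1 -> dot q q = 1 -> dot v q = 0 -> 0 < cos c ->
  let s := dir v q (a + c) + dir v q (a - c) in
  (enorm s)^-1 *: s = dir v q a.
Proof.
move=> v1 q1 vq c0 /=; rewrite dir_mid.
have -> : enorm ((2 * cos c) *: dir v q a) = 2 * cos c.
  rewrite /enorm dotZl dotZr dot_dir_dir// mulr1 -expr2 sqrtr_sqr ger0_norm//.
  by rewrite mulr_ge0// ltW.
by rewrite scalerA mulVf ?scale1r// mulf_neq0// gt_eqF.
Qed.

(* Since [dot (dir v q (a + b)) u = f a * cos b + f' a * sin b] with
   [f a ^ 2 + f' a ^ 2] the squared length of the projection of [u], a sign
   change of [f] between [a] and [a + b] forces [|f a|] to be small. *)
Lemma dir_sign_change v q u a b :
  0 <= cos b -> dot (dir v q a) u * dot (dir v q (a + b)) u <= 0 ->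
  cos b ^+ 2 * (dot v u ^+ 2 + dot q u ^+ 2) <=
    dot (dir v q (a + pi / 2)) u ^+ 2.
Proof.
move=> b0; set f := dot (dir v q a) u.
set g := dot (dir v q (a + pi / 2)) u.
have -> : dot (dir v q (a + b)) u = f * cos b + g * sin b.
  by rewrite /f /g dir_pihalf /dir cosD sinD !dot_lin; ring.
have <- : f ^+ 2 + g ^+ 2 = dot v u ^+ 2 + dot q u ^+ 2.
  rewrite /f /g dir_pihalf /dir !dot_lin -[RHS]mul1r -(cos2Dsin2 a); ring.
have := cos2Dsin2 b; move: b0.
set C := cos b; set S := sin b => C0 CS fg.
(* The sign change reads [f * (f * C + g * S) <= 0]. Squaring and cancelling [f ^+ 2] gives
   [f ^+ 2 * C ^+ 2 <= g ^+ 2 * S ^+ 2]; adding [g ^+ 2 * C ^+ 2] to both sides concludes. *)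
have h1 : f ^+ 2 * C <= - (f * g * S) by nra.
have h2 : (f ^+ 2 * C) ^+ 2 <= (f * g * S) ^+ 2.
  rewrite -[leRHS]sqrrN ler_sqr ?nnegrE//.
    by rewrite mulr_ge0// sqr_ge0.
  by apply: le_trans h1; rewrite mulr_ge0// sqr_ge0.
have [f0|fn0] := eqVneq f 0.
  rewrite f0 expr0n add0r mulrC ler_piMr ?sqr_ge0//.
  by have := sqr_ge0 S; lra.
have h3 : f ^+ 2 * C ^+ 2 <= g ^+ 2 * S ^+ 2.
  rewrite -(@ler_pM2l _ (f ^+ 2)); last by rewrite exprn_even_gt0.
  by apply: le_trans (le_trans _ h2) _; rewrite le_eqVlt; apply/orP; left; apply/eqP; ring.
nra.
Qed.

End dir_theory.

(* Halvings only occur at radii larger than [2 * r * t]. *)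
Definition halved (R : realType) (rx : \bar R) (t h : R) (k : nat) : Prop :=
  k = 0%N \/ forall r, 0 < r -> (r%:E <= rx)%E -> r * t < h / 2 ^+ k.

Lemma halvedD (R : realType) (rx : \bar R) (t h : R) (k l : nat) :
  halved rx t h k -> halved rx t (h / 2 ^+ k) l -> halved rx t h (k + l).
Proof.
move=> hk [->|hl]; first by rewrite addn0.
right=> r r0 rrx; apply: lt_le_trans (hl r r0 rrx) _.
by rewrite exprD invfM mulrA.
Qed.

(** * Line search and bisection when all heights are at least [t] *)

Section deterministic.
Variables (R : realType) (d : nat) (le : rel 'rV[R]_d) (x nx : 'rV[R]_d).
Variables (rx : \bar R) (t : R).
Hypothesis le_complete : total le.
Hypothesis outward : forall u, 0 < dot u nx -> ~~ le (x + u) x.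
Hypothesis inward : forall r u, 0 < r -> (r%:E <= rx)%E ->
  dot u u + 2 * r * dot u nx <= 0 -> le (x + u) x.
Hypothesis rx0 : (0 < rx)%E.
Hypothesis t0 : 0 < t.

Lemma inward_scale (r h : R) (u : 'rV[R]_d) : 0 < r -> (r%:E <= rx)%E ->
  0 < h -> dot u u = 1 -> dot u nx <= - t -> h <= 2 * r * t -> le (x + h *: u) x.
Proof.
move=> r0 rrx h_gt0 u1 ut hrt; apply: (inward r0 rrx).
rewrite !dot_lin u1.
have rd : h + 2 * r * dot u nx <= 0 by nra.
nra.
Qed.

Lemma le_addZ_lt0 (u : 'rV[R]_d) (h : R) : 0 < h -> dot u nx != 0 ->
  le (x + h *: u) x -> dot u nx < 0.
Proof.
move=> h_gt0 u0; apply: contraTT; rewrite -leNgt le_eqVlt eq_sym (negbTE u0)/=.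
by move=> ux; apply: outward; rewrite dotZl mulr_gt0.
Qed.

(** [outward] excludes the point on the side of [nx], so the loop can only stop because the opposite
    point is in the sublevel set. The sign is thus read correctly at any stopping radius, however
    large. *)
Lemma line_search_spec (u : 'rV[R]_d) (h : R) : 0 < h -> dot u u = 1 ->
  t <= `|dot u nx| -> exists k,
  [/\ line_search le x u h = Some (h / 2 ^+ k, h / 2 ^+ k, (2 * k.+1)%N),
      halved rx t h k,
      le (x + (h / 2 ^+ k) *: u) x = (dot u nx < 0)
    & le (x - (h / 2 ^+ k) *: u) x = (0 < dot u nx)].
Proof.
move=> h_gt0 u1 ut.
have hk0 k : 0 < h / 2 ^+ k by rewrite divr_gt0// exprn_gt0.
have un0 : dot u nx != 0.
  by apply: contraTneq ut => ->; rewrite normr0 -ltNge.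
have stopP r k : 0 < r -> (r%:E <= rx)%E -> h / 2 ^+ k <= 2 * r * t ->
    le (x + (h / 2 ^+ k) *: u) x || le (x - (h / 2 ^+ k) *: u) x.
  move=> r0 rrx hk; have [u_lt0|u_ge0] := ltP (dot u nx) 0.
    apply/orP; left; apply: inward_scale hk => //.
    by move: ut; rewrite ltr0_norm//; lra.
  apply/orP; right; rewrite -scalerN; apply: inward_scale hk => //.
    by rewrite !dot_lin opprK.
  by move: ut; rewrite ger0_norm// dotNl; lra.
have testE (k : nat) : prec le x (x + (h / 2 ^+ k) *: u)
    && prec le x (x - (h / 2 ^+ k) *: u) =
    ~~ (le (x + (h / 2 ^+ k) *: u) x || le (x - (h / 2 ^+ k) *: u) x).
  by rewrite !prec_total// negb_or.
rewrite /line_search; case: pselect => [e|]; last first.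
  case; have [r r0 rrx] : exists2 r : R, 0 < r & (r%:E <= rx)%E.
    case: (rx) rx0 => [r r0|_|//]; first by exists r.
    by exists 1 => //; rewrite leey.
  have : exists k : nat, h / 2 ^+ k <= 2 * r * t.
    have [k hk] : exists k : nat, h / (2 * r * t) <= k%:R.
      by exists (Num.bound (h / (2 * r * t))); apply/ltW/archi_boundP; rewrite divr_ge0// ?mulr_ge0// ltW.
    exists k; rewrite ler_pdivrMr ?exprn_gt0//.
    rewrite mulrC -ler_pdivrMr ?mulr_gt0//; apply: le_trans hk _.
    by rewrite -natrX ler_nat ltnW// ltn_expl.
  by case=> k hk; exists k; rewrite testE negbK (stopP r).
case: ex_minnP => k; rewrite testE negbK => stop kmin.
exists k; split=> //.
- case: k stop kmin => [|k] stop kmin; [by left|right => r r0 rrx].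
  (* The radius before the last halving is twice the final one; had it been at most [2 * r * t], the
     loop would have stopped at [k]. *)
  rewrite ltNge; apply/negP => hk.
  have := kmin k; rewrite testE negbK ltnn => /(_ _)/wrap[]//.
  apply: (stopP r) => //; move: hk; rewrite exprS invfM mulrCA; lra.
- apply/idP/idP; first exact: le_addZ_lt0.
  move=> ult0; have : ~~ le (x - (h / 2 ^+ k) *: u) x.
    by rewrite -scalerN; apply: outward; rewrite !dot_lin mulrN oppr_gt0 nmulr_llt0.
  by move: stop => /orP[//|->].
- apply/idP/idP => [|ugt0].
    rewrite -scalerN => /(le_addZ_lt0 (hk0 k)).
    by rewrite dotNl oppr_eq0 oppr_lt0; apply.
  have : ~~ le (x + (h / 2 ^+ k) *: u) x by apply: outward; rewrite dotZl mulr_gt0.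
  by move: stop => /orP[->|//].
Qed.

Variables (v q : 'rV[R]_d) (theta : R) (T : nat).
Hypotheses (v1 : dot v v = 1) (q1 : dot q q = 1) (vq : dot v q = 0).
Local Notation beta := (pi / 2 ^+ T.+1 : R).
Local Notation ang m := (theta + m%:R * beta).
Hypothesis good : forall m : nat, t <= `|dot (dir v q (ang m)) nx|.

Let expr2nz k : (2 : R) ^+ k != 0. Proof. by rewrite expf_neq0. Qed.

(** The bracket is a pair of grid indices at distance [2 ^ T'], in either order, with heights of
    opposite signs. Halving keeps the indices integral, and at distance 1 the returned angle has a
    neighbour across the sign change. [last] is an end of the bracket as soon as one midpoint has
    been computed. *)
Lemma bisection_spec (T' a b : nat) (last : 'rV[R]_d) (h : R) :
  (T' <= T)%N -> 0 < h -> (a + 2 ^ T' = b \/ b + 2 ^ T' = a)%N ->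
  0 < dot (dir v q (ang a)) nx -> dot (dir v q (ang b)) nx < 0 ->
  (T' = 0%N -> last = dir v q (ang a) \/ last = dir v q (ang b)) ->
  exists k m m',
  [/\ bisection le x T' (dir v q (ang a)) (dir v q (ang b)) last h =
        Some (dir v q (ang m), h / 2 ^+ k, 2 * T' + 2 * k)%N,
      halved rx t h k, (m' = m.+1 \/ m = m'.+1)
    & dot (dir v q (ang m)) nx * dot (dir v q (ang m')) nx <= 0].
Proof.
elim: T' a b last h => [|T' IH] a b last h T'T h_gt0 ab fa fb lastE.
  exists 0%N; have [->|->] := lastE erefl.
    exists a, b; rewrite /= expr0 divr1; split => //; first by left.
    - by move: ab; rewrite expn0 !addn1 => -[<-|<-]; [left|right].
    - by rewrite pmulr_rle0// ltW.
  exists b, a; rewrite /= expr0 divr1; split => //; first by left.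
  - by move: ab; rewrite expn0 !addn1 => -[<-|<-]; [right|left].
  - by rewrite nmulr_rle0// ltW.
have [c [abc ac cb]] : exists c, [/\ (a = c + 2 ^ T' /\ b + 2 ^ T' = c \/
    c = a + 2 ^ T' /\ b = c + 2 ^ T')%N, (a + 2 ^ T' = c \/ c + 2 ^ T' = a)%N
    & (c + 2 ^ T' = b \/ b + 2 ^ T' = c)%N].
  by move: ab; rewrite expnS mul2n -addnn => -[<-|<-];
    [exists (a + 2 ^ T')%N|exists (b + 2 ^ T')%N]; split; lia.
have cosg : 0 < cos ((2 ^ T')%:R * beta).
  apply: cos_gt0_pihalf; rewrite natrX; apply/andP; split.
    apply: (@lt_le_trans _ _ 0); first by rewrite oppr_lt0 divr_gt0 ?pi_gt0.
    by rewrite mulr_ge0 ?exprn_ge0// divr_ge0 ?pi_ge0// exprn_ge0.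
  rewrite mulrCA ltr_pM2l ?pi_gt0//.
  rewrite ltr_pdivrMr ?exprn_gt0// exprS mulKf// ltr_eXn2l ?ltr1n//.
have mid : (enorm (dir v q (ang a) + dir v q (ang b)))^-1 *:
    (dir v q (ang a) + dir v q (ang b)) = dir v q (ang c).
  rewrite -(normalize_mid (ang c) v1 q1 vq cosg) /=.
  have [[-> <-]|[-> ->]] := abc.
    by rewrite !natrD !mulrDl !addrA addrK.
  rewrite [X in enorm X]addrC [X in _ *: X = _]addrC.
  by rewrite !natrD !mulrDl !addrA addrK.
have [k1 [lsE hk1 lec _]] :=
  line_search_spec h_gt0 (dot_dir_dir (ang c) v1 q1 vq) (good c).
have hk0 : 0 < h / 2 ^+ k1 by rewrite divr_gt0// exprn_gt0.
rewrite /= mid /cbind lsE lec; case: ltP => fc.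
  have [|k2 [m [m' [-> hk2 mm' fm]]]] :=
    IH a c (dir v q (ang c)) (h / 2 ^+ k1) (ltnW T'T) hk0 ac fa fc.
    by right.
  exists (k1 + k2)%N, m, m'; split => //; last exact: halvedD hk1 hk2.
  by rewrite exprD invfM (mulrA h); congr (Some (_, _)); clear; lia.
have {}fc : 0 < dot (dir v q (ang c)) nx.
  rewrite lt_neqAle fc andbT eq_sym; apply: contraTneq (good c) => ->.
  by rewrite normr0 -ltNge.
have [|k2 [m [m' [-> hk2 mm' fm]]]] :=
  IH c b (dir v q (ang c)) (h / 2 ^+ k1) (ltnW T'T) hk0 cb fc fb.
  by left.
exists (k1 + k2)%N, m, m'; split => //; last exact: halvedD hk1 hk2.
by rewrite exprD invfM (mulrA h); congr (Some (_, _)); clear; lia.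
Qed.

Lemma ang0 : ang 0 = theta. Proof. by rewrite mul0r addr0. Qed.

Lemma ang_pihalf m : ang (m + 2 ^ T) = ang m + pi / 2.
Proof.
rewrite natrD mulrDl addrA natrX; congr (_ + _).
by rewrite exprS; field; rewrite expr2nz.
Qed.

(** By [line_search_spec] exactly one of the two points is no worse than [x]. The early exit can
    then only come from [x] being no worse than both, that is, from a tie. Otherwise the ends of the
    bracket are a quarter turn apart, which is [2 ^ T] grid steps. The count [T + 2] includes the
    two searches made before the bisection. *)
Lemma aplanar_spec (h : R) : (0 < T)%N -> 0 < h ->
  exists k m N,
  [/\ aplanar le x v q T theta h = Some (dir v q (ang m), h / 2 ^+ k, N),
      halved rx t h k, (N <= 2 * (T + 2) + 2 * k)%N
    & (forall j, ~~ indiff le (x + (h / 2 ^+ j) *: dir v q theta) x /\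
                 ~~ indiff le (x - (h / 2 ^+ j) *: dir v q theta) x) ->
      exists m', (m' = m.+1 \/ m = m'.+1) /\
      dot (dir v q (ang m)) nx * dot (dir v q (ang m')) nx <= 0].
Proof.
move=> T0 h_gt0.
have abarE : cos theta *: v + sin theta *: q = dir v q (ang 0) by rewrite ang0.
have bbarE : - sin theta *: v + cos theta *: q = dir v q (ang (2 ^ T)).
  by rewrite -dir_pihalf -[in RHS](add0n (2 ^ T)%N) ang_pihalf ang0.
(* The opposite of [abar] receives the index of a positive half turn, so that all indices stay
   natural numbers. *)
have NabarE : - dir v q (ang 0) = dir v q (ang (2 ^ T + 2 ^ T)).
  rewrite ang_pihalf -{1}(add0n (2 ^ T)%N) ang_pihalf -dirDpi.
  by congr (dir _ _ _); field.
have [k1 [lsE hk1 lep lem]] :=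
  line_search_spec h_gt0 (dot_dir_dir (ang 0) v1 q1 vq) (good 0).
have hk0 : 0 < h / 2 ^+ k1 by rewrite divr_gt0// exprn_gt0.
have [k2 [lsE2 hk2 lep2 _]] :=
  line_search_spec hk0 (dot_dir_dir (ang (2 ^ T)) v1 q1 vq) (good (2 ^ T)).
have hk20 : 0 < h / 2 ^+ k1 / 2 ^+ k2 by rewrite divr_gt0// exprn_gt0.
rewrite /aplanar abarE bbarE /cbind lsE lep lem.
have fN : dot (dir v q (ang (2 ^ T + 2 ^ T))) nx = - dot (dir v q (ang 0)) nx.
  by rewrite -NabarE dotNl.
case: ifPn => [exit|noexit].
  exists k1, 0%N, (2 * k1.+1)%N; split.
  - by rewrite /cret addn0.
  - exact: hk1.
  - by clear; lia.
  move=> notie; have [tiep tiem] := notie k1.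
  have thetaE : dir v q theta = dir v q (ang 0) by rewrite ang0.
  move: exit tiep tiem; rewrite thetaE /indiff lep lem.
  move=> /orP[/andP[]|/andP[-> ->]]; last first.
    rewrite !andbT; have := good 0; case: ltgtP => //= ->.
    by rewrite normr0 leNgt t0.
  by move=> /lt_trans/[apply]; rewrite ltxx.
rewrite lsE2 lep2 NabarE.
have fin (a b : nat) : (a + 2 ^ T = b \/ b + 2 ^ T = a)%N ->
  0 < dot (dir v q (ang a)) nx -> dot (dir v q (ang b)) nx < 0 ->
  exists k m N,
  [/\ match (match bisection le x T (dir v q (ang a)) (dir v q (ang b))
                 (dir v q (ang 0)) (h / 2 ^+ k1 / 2 ^+ k2) with
             | Some (b0, h2, N2) => Some (b0, h2, (2 * k2.+1 + N2)%N)
             | None => None end) with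
      | Some (b0, h2, N2) => Some (b0, h2, (2 * k1.+1 + N2)%N)
      | None => None end = Some (dir v q (ang m), h / 2 ^+ k, N),
      halved rx t h k, (N <= 2 * (T + 2) + 2 * k)%N
    & (forall j, ~~ indiff le (x + (h / 2 ^+ j) *: dir v q theta) x /\
                 ~~ indiff le (x - (h / 2 ^+ j) *: dir v q theta) x) ->
      exists m', (m' = m.+1 \/ m = m'.+1) /\
      dot (dir v q (ang m)) nx * dot (dir v q (ang m')) nx <= 0].
  move=> ab fa fb; have [|k3 [m [m' [-> hk3 mm' fm]]]] :=
    @bisection_spec T a b (dir v q (ang 0)) _ (leqnn T) hk20 ab fa fb.
    by move=> T00; rewrite T00 in T0.
  exists (k1 + k2 + k3)%N, m; eexists; split; last 1 first.
  - by move=> _; exists m'.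
  - by rewrite !exprD !invfM !mulrA.
  - apply: halvedD; first exact: halvedD hk1 hk2.
    by rewrite exprD invfM mulrA.
  - by clear; lia.
have nz (m : nat) : (0 < dot (dir v q (ang m)) nx) = ~~ (dot (dir v q (ang m)) nx < 0).
  rewrite -leNgt lt_neqAle eq_sym; case: eqVneq => //= z.
  by have := good m; rewrite z normr0 => /(lt_le_trans t0); rewrite ltxx.
case: (boolP (dot (dir v q (ang 0)) nx < 0)) => [f0|f0];
  case: (boolP (dot (dir v q (ang (2 ^ T))) nx < 0)) => [f1|f1]; apply: fin;
  rewrite ?add0n ?fN ?oppr_lt0 ?oppr_gt0 ?nz//; by [left|right].
Qed.

End deterministic.

(** * The loop over the planes *)

Section loop_def.
Variables (R : realType) (n : nat) (le : rel 'rV[R]_n.+1) (x : 'rV[R]_n.+1).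
Variables (T : nat) (Q : 'M[R]_n.+1) (theta : 'I_n -> R).

Definition ane_prefix (i : nat) : Defs.comp R 'rV[R]_n.+1 :=
  ane_loop le x T Q theta (take i (enum 'I_n)) (row ord0 Q).

(* The direction [v_(i+1)] entering the plane of index [i]; the junk value 0
   stands for nontermination. *)
Definition prefix_dir (h0 : R) (i : nat) : 'rV[R]_n.+1 :=
  if ane_prefix i h0 is Some (v, _, _) then v else 0.

(** The loop unfolds at its first plane, whereas the induction on prefixes adds a last one. *)
Lemma ane_loop_rcons (s : seq 'I_n) (i : 'I_n) (v : 'rV[R]_n.+1) (h : R) :
  ane_loop le x T Q theta (rcons s i) v h =
  cbind (ane_loop le x T Q theta s v) (fun w =>
    let q := row (lift ord0 i) Q in
    cbind (aplanar le x w q T (theta i))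
      (fun y => cret (- dot y q *: w + dot y w *: q))) h.
Proof.
elim: s v h => [|j s IH] v h /=.
  by rewrite /cbind /cret; case: (aplanar _ _ _ _ _ _ _) => // -[[y h1] N].
rewrite {1 2 3}/cbind; case: (aplanar _ _ _ _ _ _ _) => // -[[y h1] N].
rewrite IH /cbind; case: (ane_loop _ _ _ _ _ _ _ _) => // -[[y1 h2] N2] /=.
case: (aplanar _ _ _ _ _ _ _) => // -[[y2 h3] N3] /=.
by rewrite addnA.
Qed.

(* The possible [v_i] in coordinates with respect to the frame: [v_(i+1)] makes
   an angle [theta_i + m * beta + pi / 2] with [v_i], [m] depending on the
   comparisons. The most recent plane comes first in the list. *)
Fixpoint frame_coords (beta : R) (l : seq ('I_n * nat)) : 'rV[R]_n.+1 :=
  if l is (i, m) :: l' then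
    dir (frame_coords beta l') (delta_mx 0 (lift ord0 i))
        (theta i + m%:R * beta + pi / 2)
  else delta_mx 0 ord0.

End loop_def.

Section loop.
Variables (R : realType) (n : nat) (le : rel 'rV[R]_n.+1) (x nx : 'rV[R]_n.+1).
Variables (rx : \bar R) (t : R).
Hypothesis le_complete : total le.
Hypothesis outward : forall u, 0 < dot u nx -> ~~ le (x + u) x.
Hypothesis inward : forall r u, 0 < r -> (r%:E <= rx)%E ->
  dot u u + 2 * r * dot u nx <= 0 -> le (x + u) x.
Hypothesis rx0 : (0 < rx)%E.
Hypothesis t0 : 0 < t.
Hypothesis nx1 : dot nx nx = 1.
Variables (T : nat) (Q : 'M[R]_n.+1) (theta : 'I_n -> R) (h0 : R).
Hypotheses (T0 : (0 < T)%N) (oQ : orthogonal_mx Q) (hh0 : 0 < h0).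
Local Notation beta := (pi / 2 ^+ T.+1 : R).
Local Notation coords := (frame_coords theta beta).
Hypothesis good : forall (i : 'I_n) (m : nat),
  t <= `|dot (dir (prefix_dir le x T Q theta h0 i) (row (lift ord0 i) Q)
               (theta i + m%:R * beta)) nx|.

(** All candidates are covered, not only those reached: which ones are reached depends on the frame,
    while [coords l] depends on the angles alone. The unit condition discards lists, such as some
    that repeat a plane, that do not give a direction. *)
Definition no_tie : Prop := forall l (k : nat),
  dot (coords l) (coords l) = 1 ->
  ~~ indiff le (x + (h0 / 2 ^+ k) *: (coords l *m Q)) x.

Lemma dir_mulmx (v q : 'rV[R]_n.+1) a : dir v q a *m Q = dir (v *m Q) (q *m Q) a.
Proof. by rewrite /dir mulmxDl !scalemxAl. Qed.

Lemma cos_beta_ge0 : 0 <= cos beta.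
Proof.
apply: cos_ge0_pihalf; apply/andP; split.
  apply: (@le_trans _ _ 0); first by rewrite oppr_le0 divr_ge0 ?pi_ge0.
  by rewrite divr_ge0 ?pi_ge0// exprn_ge0.
rewrite ler_wpM2l ?pi_ge0// lef_pV2 ?posrE ?exprn_gt0//.
by rewrite exprS ler_peMr// exprn_ege1// ler1n.
Qed.

(** By [dir_sign_change], a plane turns the squared height into at least [cos beta ^+ 2] times its
    sum with the next squared frame coefficient of [nx]. The vanishing later coordinates keep the
    direction orthogonal to the next frame vector. The new direction is a quarter turn from a grid
    angle, hence on the grid itself, and so inherits the bound [t]. *)
Lemma ane_prefix_spec (i : nat) : (i <= n)%N -> exists k N l,
  [/\ ane_prefix le x T Q theta i h0 = Some (coords l *m Q, h0 / 2 ^+ k, N),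
      halved rx t h0 k, (N <= 2 * i * (T + 2) + 2 * k)%N,
      dot (coords l) (coords l) = 1
        /\ (forall j : 'I_n.+1, (i < j)%N -> coords l 0 j = 0)
    & ((0 < i)%N -> t <= `|dot (coords l *m Q) nx|)
      /\ (no_tie -> (cos beta ^+ 2) ^+ i *
            \sum_(j < n.+1 | (j <= i)%N) dot (row j Q) nx ^+ 2
              <= dot (coords l *m Q) nx ^+ 2)].
Proof.
elim: i => [_|i IH iltn].
  exists 0%N, 0%N, [::]; split => //.
  - by rewrite /ane_prefix take0 /= /cret rowE expr0 divr1.
  - by left.
  - split=> [|j j0]; first by rewrite dot_delta mxE !eqxx.
    by rewrite mxE eqxx /=; case: eqP j0 => // ->.
  - split=> // _; rewrite expr0 mul1r (big_pred1 ord0) ?rowE// => j.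
    by rewrite leqn0.
have {IH}[k [N [l [preE hk hN [l1 l0] [_ acc]]]]] := IH (ltnW iltn).
pose o : 'I_n := Ordinal iltn.
have take_s : take i.+1 (enum 'I_n) = rcons (take i (enum 'I_n)) o.
  rewrite (take_nth o) ?size_enum_ord//; congr rcons.
  by apply: val_inj; rewrite /= nth_enum_ord.
set v := coords l *m Q in preE acc *; set q := row (lift ord0 o) Q.
have v1 : dot v v = 1 by rewrite /v dot_mulmx.
have q1 : dot q q = 1 by rewrite /q dot_row// eqxx.
have vq : dot v q = 0.
  by rewrite /v /q rowE dot_mulmx// dotC dot_delta l0//= /bump.
have hk0 : 0 < h0 / 2 ^+ k by rewrite divr_gt0// exprn_gt0.
have goodv m : t <= `|dot (dir v q (theta o + m%:R * beta)) nx|.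
  by have := good o m; rewrite /prefix_dir preE.
have [k2 [m [N2 [apE hk2 hN2 acc2]]]] :=
  aplanar_spec le_complete outward inward rx0 t0 v1 q1 vq goodv T0 hk0.
have coordsE l' (m' : nat) : coords ((o, m') :: l') =
    dir (coords l') (delta_mx 0 (lift ord0 o)) (theta o + m'%:R * beta + pi / 2).
  by [].
have cQ (m' : nat) : coords ((o, m') :: l) *m Q =
    dir v q (theta o + m'%:R * beta + pi / 2).
  by rewrite coordsE dir_mulmx /v /q rowE.
have c1 (m' : nat) : dot (coords ((o, m') :: l)) (coords ((o, m') :: l)) = 1.
  by rewrite -(dot_mulmx _ _ oQ) cQ dot_dir_dir.
exists (k + k2)%N, (N + N2)%N, ((o, m) :: l); split.
- rewrite /ane_prefix take_s ane_loop_rcons.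
  move: preE; rewrite /ane_prefix => preE; rewrite {1}/cbind preE.
  rewrite -/q {1}/cbind apE /cret addn0 exprD invfM (mulrA h0) cQ.
  congr (Some (_, _, _)); rewrite dir_pihalf; set phi := theta o + _.
  by congr (_ *: _ + _ *: _); rewrite dot_dir ?q1 ?vq ?v1 ?(dotC q v) ?vq; ring.
- exact: halvedD hk hk2.
- by move: hN hN2; clear; nia.
- split; first exact: c1.
  move=> j ij; rewrite coordsE /dir !mxE l0; last exact: ltnW.
  rewrite mulr0 add0r; case: (j =P lift ord0 o) => [jo|]; last by rewrite andbF mulr0.
  by move: ij; rewrite jo /= /bump /= ltnn.
split=> [_|notie].
  by rewrite cQ -(@ang_pihalf _ (theta o) T); exact: goodv.
have [j|m' [mm' fm]] := acc2.
  have beta4 : (2 ^ T)%:R * beta = pi / 2.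
    by rewrite natrX exprS; field; rewrite expf_neq0.
  rewrite -!mulrA -!invfM -!exprD; split.
    (* Candidates carry an extra quarter turn: [3 * 2 ^ T] further steps complete a full turn and
       give [abar], and [2 ^ T] steps complete a half turn and give [- abar]. *)
    rewrite (_ : dir v q _ = coords ((o, 3 * 2 ^ T)%N :: l) *m Q); first exact: notie.
    rewrite cQ natrM -mulrA beta4.
    rewrite (_ : _ + _ = theta o + pi + pi); last by field.
    by rewrite !dirDpi opprK.
  rewrite -scalerN.
  rewrite (_ : - dir v q _ = coords ((o, 2 ^ T)%N :: l) *m Q); first exact: notie.
  by rewrite cQ beta4 -dirDpi; congr (dir _ _ _); field.
have key : cos beta ^+ 2 * (dot v nx ^+ 2 + dot q nx ^+ 2) <=
    dot (coords ((o, m) :: l) *m Q) nx ^+ 2.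
  have betaS (j : nat) : j.+1%:R * beta = j%:R * beta + beta.
    by rewrite -(natr1 j) mulrDl mul1r.
  rewrite cQ; have [mm'1|mm'1] := mm'.
    apply: dir_sign_change; first exact: cos_beta_ge0.
    by move: fm; rewrite mm'1 betaS addrA.
  rewrite -(cosN beta); apply: dir_sign_change; first by rewrite cosN cos_beta_ge0.
  by move: fm; rewrite mm'1 betaS addrA addrK.
apply: le_trans key.
rewrite exprS -mulrA ler_wpM2l ?sqr_ge0//.
rewrite (bigD1 (lift ord0 o)) /=; last by rewrite /bump.
rewrite mulrDr addrC lerD//.
  rewrite (eq_bigl (fun j : 'I_n.+1 => (j <= i)%N)); first exact: acc.
  move=> j /=; rewrite -val_eqE /= /bump /= add1n.
  by move: (nat_of_ord j) => jj; clear; lia.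
by rewrite ler_piMl ?sqr_ge0// exprn_ile1 ?sqr_ge0// exprn_ile1 ?cos_beta_ge0 ?cos_le1.
Qed.

(** For unit vectors the squared distance is [2 - 2 * dot nhat nx], so a height of [1 - e ^+ 2 / 2]
    is what is required. Over the whole frame, Parseval turns the bound of [ane_prefix_spec] into
    [cos beta ^+ n]. *)
Lemma ane_spec (e : R) : (0 < n)%N -> 0 < e -> 1 - e ^+ 2 / 2 <= cos beta ^+ n ->
  exists nhat k N,
  [/\ ane le x T Q theta h0 = Some (nhat, h0 / 2 ^+ k, N),
      halved rx t h0 k, (N <= 2 * n * (T + 2) + 2 + 2 * k)%N
    & no_tie -> enorm (nhat - nx) <= e].
Proof.
move=> n0 e0 he.
have [k [N [l [preE hk hN [l1 _] [ge acc]]]]] := ane_prefix_spec (leqnn n).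
set v := coords l *m Q in preE ge acc.
have v1 : dot v v = 1 by rewrite /v dot_mulmx.
have hk0 : 0 < h0 / 2 ^+ k by rewrite divr_gt0// exprn_gt0.
have [k2 [lsE hk2 lep lem]] :=
  line_search_spec le_complete outward inward rx0 t0 hk0 v1 (ge n0).
have aneE : ane le x T Q theta h0 = Some
    (if prec le (x + (h0 / 2 ^+ k / 2 ^+ k2) *: v) x then - v else v,
     h0 / 2 ^+ (k + k2), (N + (2 * k2.+1))%N).
  rewrite /ane; move: preE; rewrite /ane_prefix take_oversize ?size_enum_ord//.
  move=> preE; rewrite {1}/cbind preE {1}/cbind lsE /cret addn0.
  by rewrite exprD invfM mulrA.
exists (if prec le (x + (h0 / 2 ^+ k / 2 ^+ k2) *: v) x then - v else v).
exists (k + k2)%N, (N + (2 * k2.+1))%N; split => //.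
- exact: halvedD hk hk2.
- by move: hN; clear; nia.
move=> notie.
(* The last comparison is strict whereas [line_search_spec] describes a weak one; without ties they
   agree. *)
have -> : prec le (x + (h0 / 2 ^+ k / 2 ^+ k2) *: v) x = (dot v nx < 0).
  have := notie l (k + k2)%N l1; rewrite -/v /indiff /prec exprD invfM mulrA lep.
  by case: (dot v nx < 0) => //=; move=> ->.
have absge : 1 - e ^+ 2 / 2 <= `|dot v nx|.
  apply: le_trans he _.
  rewrite -(@ler_pXn2r _ 2) ?nnegrE ?exprn_ge0 ?cos_beta_ge0//.
  rewrite real_normK ?num_real// exprAC.
  apply: le_trans (acc notie).
  rewrite (eq_bigl xpredT); last by move=> j /=; rewrite -ltnS ltn_ord.
  by rewrite parseval// nx1 mulr1.
rewrite enorm_le; last exact: ltW.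
case: ifPn => vn; rewrite !dot_lin v1 nx1 (dotC nx v).
  by move: absge; rewrite ltr0_norm//; lra.
by move: absge; rewrite -leNgt in vn; rewrite ger0_norm//; lra.
Qed.

End loop.

(** * Measurability *)

Section matrix_measurability.
Context {disp : measure_display} {T : measurableType disp} {R : realType}.

Lemma rat_approx (y e : R) : 0 < e -> exists p : rat, `|ratr p - y| < e.
Proof.
move=> e0; have [p] := @rat_in_itvoo R (y - e) (y + e) ltac:(lra).
by rewrite in_itv/= => /andP[? ?]; exists p; rewrite ltr_norml; lra.
Qed.

(** An open set is the union of the boxes it contains with rational centre and radius [1 / k.+1],
    which are countably many. *)
Lemma measurable_preimage_open (m n : nat) (F : T -> 'M[R]_(m, n))
    (U : set 'M[R]_(m, n)) :
  (forall i j, measurable_fun setT (fun w => F w i j)) -> open U ->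
  measurable (F @^-1` U).
Proof.
move=> mF oU.
pose B (pk : 'M[rat]_(m, n) * nat) := [set w | forall i j,
  `|ratr (pk.1 i j) - F w i j| < pk.2.+1%:R^-1].
pose good (pk : 'M[rat]_(m, n) * nat) := forall M : 'M[R]_(m, n),
  (forall i j, `|ratr (pk.1 i j) - M i j| < pk.2.+1%:R^-1) -> U M.
have -> : F @^-1` U = \bigcup_pk [set w | good pk /\ B pk w].
  apply/seteqP; split => [w Uw|w [pk _ [gpk Bw]]]; last exact: gpk.
  have : nbhs (F w) U by exact: open_nbhs_nbhs.
  move=> /nbhs_ballP[e /= e0 eU].
  have [k ke] : exists k : nat, k.+1%:R^-1 + k.+1%:R^-1 <= e.
    have := archi_boundP (ltW (divr_gt0 (ltr0Sn R 1) e0)) : 2 / e < _.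
    set N := Num.bound _ => Ne; exists N.
    have a0 : (0 : R) < N.+1%:R by rewrite ltr0n.
    rewrite -(ler_pM2l a0) mulrDr divff ?gt_eqF//.
    rewrite ltr_pdivrMr// in Ne; apply: ltW; apply: lt_le_trans Ne _.
    by rewrite ler_wpM2r ?ler_nat// ltW.
  have apx i j := rat_approx (F w i j) (e := k.+1%:R^-1) ltac:(by rewrite invr_gt0 ltr0n).
  exists (\matrix_(i, j) sval (cid (apx i j)), k) => //=.
  have Bw : B (\matrix_(i, j) sval (cid (apx i j)), k) w.
    by move=> i j /=; rewrite mxE; case: cid.
  split=> // M /= Mp; apply: eU; split => // i j.
  rewrite /ball /= (lt_le_trans _ ke)//.
  have := ltrD (Bw i j) (Mp i j); apply: le_lt_trans => /=.
  by rewrite distrC -[in leRHS]distrC distrC; exact: ler_distD.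
apply: countable_bigcupT_measurable => // -[p k].
have [g|g] := pselect (good (p, k)); last first.
  by rewrite (_ : [set _ | _] = set0)//; apply/seteqP; split => // w [].
rewrite (_ : [set _ | _] = \bigcap_(ij in [set: 'I_m * 'I_n])
    [set w | `|ratr (p ij.1 ij.2) - F w ij.1 ij.2| < k.+1%:R^-1]); last first.
  apply/seteqP; split => [w [_ Bw] [i j] _|w Bw]; first exact: Bw.
  by split=> // i j; exact: (Bw (i, j)).
apply: fin_bigcap_measurable => // -[i j] _ /=.
rewrite -[X in measurable X]setTI.
rewrite (_ : [set w | _] = (fun w => `|ratr (p i j) - F w i j|) @^-1` `]-oo, k.+1%:R^-1[%classic).
  have mf : measurable_fun setT (fun w => `|ratr (p i j) - F w i j|).
    apply: (measurableT_comp (@normr_measurable R setT)).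
    by apply: measurable_funB => //; exact: measurable_cst.
  exact: mf.
by apply/seteqP; split => w /=; rewrite in_itv.
Qed.

Lemma measurable_preimage_closed (m n : nat) (F : T -> 'M[R]_(m, n))
    (U : set 'M[R]_(m, n)) :
  (forall i j, measurable_fun setT (fun w => F w i j)) -> closed U ->
  measurable (F @^-1` U).
Proof.
move=> mF cU; rewrite -[U]setCK preimage_setC; apply: measurableC.
exact: (measurable_preimage_open mF (closed_openC cU)).
Qed.

Lemma measurable_borel_mx (d : nat) (F : T -> 'M[R]_d) :
  (forall i j, measurable_fun setT (fun w => F w i j)) ->
  measurable_fun setT (F : T -> borel_mx R d).
Proof.
move=> mF; apply: (@measurability _ _ _ (borel_mx R d) _ _ (@open 'M[R]_d)) => //.
by move=> _ [U oU <-]; rewrite setTI; exact: measurable_preimage_open.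
Qed.

Lemma measurable_borel_entry (d : nat) (F : T -> borel_mx R d) i j :
  measurable_fun setT F -> measurable_fun setT (fun w => (F w : 'M[R]_d) i j).
Proof.
move=> mF; apply: (measurability _ (RGenOpens.measurableE R)).
move=> _ [_ [a [b ->]] <-]; rewrite setTI.
rewrite (_ : _ @^-1` _ = F @^-1` [set M : 'M[R]_d | `]a, b[%classic (M i j)])//.
rewrite -[X in measurable X]setTI; apply: mF => //; apply: sub_sigma_algebra.
apply: (@open_comp _ _ (fun M : 'M[R]_d => M i j)); last exact: interval_open.
by move=> M _; exact: coord_continuous.
Qed.

Lemma measurable_cos : measurable_fun setT (@cos R).
Proof. by apply: continuous_measurable_fun; exact: continuous_cos. Qed.

Lemma measurable_sin : measurable_fun setT (@sin R).
Proof. by apply: continuous_measurable_fun; exact: continuous_sin. Qed.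

End matrix_measurability.

(* Coordinatewise measurability avoids a Borel structure on ['rV[R]_d]. *)
Definition vmeasurable (disp : measure_display) (T : measurableType disp)
    (R : realType) (d : nat) (f : T -> 'rV[R]_d) : Prop :=
  forall j, measurable_fun setT (fun w => f w 0 j).

Arguments vmeasurable {disp T R d} f.

Section vmeasurable_theory.
Context {disp : measure_display} {T : measurableType disp} {R : realType}.
Context {d : nat}.
Implicit Types (f g : T -> 'rV[R]_d) (a : T -> R).

Lemma vmeasurable_cst (v : 'rV[R]_d) : vmeasurable (fun _ : T => v).
Proof. by move=> j; exact: measurable_cst. Qed.

Lemma vmeasurableD f g : vmeasurable f -> vmeasurable g ->
  vmeasurable (fun w => f w + g w).
Proof.
move=> mf mg j; under eq_fun do rewrite mxE.
exact: measurable_funD (mf j) (mg j).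
Qed.

Lemma vmeasurableZ a f : measurable_fun setT a -> vmeasurable f ->
  vmeasurable (fun w => a w *: f w).
Proof.
move=> ma mf j; under eq_fun do rewrite mxE.
exact: measurable_funM ma (mf j).
Qed.

Lemma vmeasurableN f : vmeasurable f -> vmeasurable (fun w => - f w).
Proof.
move=> mf j; under eq_fun do rewrite mxE.
exact: measurable_funN (mf j).
Qed.

Lemma measurable_dot f g : vmeasurable f -> vmeasurable g ->
  measurable_fun setT (fun w => dot (f w) (g w)).
Proof.
move=> mf mg; apply: measurable_sum => i.
exact: measurable_funM (mf i) (mg i).
Qed.

Lemma measurable_enormV f : vmeasurable f ->
  measurable_fun setT (fun w => (enorm (f w))^-1).
Proof.
move=> mf.
(* Real powers are measurable on the whole line and agree with the inverse at 0 as well, both being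
   0 there. *)
rewrite (_ : (fun w => _) = (fun w => ((dot (f w) (f w)) `^ 2^-1) `^ (-1))).
  apply: (measurableT_comp (measurable_powR _)).
  apply: (measurableT_comp (measurable_powR _)).
  exact: measurable_dot.
by apply/funext => w; rewrite powR_inv1 ?powR_ge0// powR12_sqrt ?dot_ge0.
Qed.

Lemma vmeasurable_dir f g a : vmeasurable f -> vmeasurable g ->
  measurable_fun setT a -> vmeasurable (fun w => dir (f w) (g w) (a w)).
Proof.
move=> mf mg ma; apply: vmeasurableD; apply: vmeasurableZ => //.
  exact: measurableT_comp measurable_cos ma.
exact: measurableT_comp measurable_sin ma.
Qed.

Lemma vmeasurable_mulmx (M : T -> borel_mx R d) f :
  measurable_fun setT M -> vmeasurable f ->
  vmeasurable (fun w => f w *m (M w : 'M[R]_d)).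
Proof.
move=> mM mf j; under eq_fun do rewrite mxE.
apply: measurable_sum => i; apply: measurable_funM; first exact: mf.
exact: measurable_borel_entry.
Qed.

Lemma vmeasurable_row (M : T -> borel_mx R d) i :
  measurable_fun setT M -> vmeasurable (fun w => row i (M w : 'M[R]_d)).
Proof.
move=> mM j; under eq_fun do rewrite mxE.
exact: measurable_borel_entry.
Qed.

Lemma vmeasurable_if (b : T -> bool) f g :
  measurable_fun setT b -> vmeasurable f -> vmeasurable g ->
  vmeasurable (fun w => if b w then f w else g w).
Proof.
move=> mb mf mg j; under eq_fun do rewrite (fun_if (fun M : 'rV[R]_d => M 0 j)).
exact: measurable_fun_ifT.
Qed.

End vmeasurable_theory.

(** The comparison count is left out, since later queries depend only on the vector and the radius.
    Termination is the event [b]; off it, [f] and [g] take arbitrary values. *)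
Definition run_measurable (disp : measure_display) (T : measurableType disp)
    (R : realType) (d : nat) (F : T -> option ('rV[R]_d * R * nat)) : Prop :=
  exists (b : T -> bool) (f : T -> 'rV[R]_d) (g : T -> R),
  [/\ measurable_fun setT b, vmeasurable f, measurable_fun setT g
    & forall w, if b w then exists N, F w = Some (f w, g w, N) else F w = None].

Section run_measurability.
Context {disp : measure_display} {T : measurableType disp} {R : realType}.
Context {d : nat}.
Variables (le : rel 'rV[R]_d) (x : 'rV[R]_d).
Hypothesis le_complete : total le.
Hypothesis hpfx : plateau_free_at le x.

Lemma measurable_le_left (y : T -> 'rV[R]_d) : vmeasurable y ->
  measurable_fun setT (fun w => le (y w) x).
Proof.
move=> my; apply: (measurable_fun_bool true); rewrite setTI.
rewrite (_ : _ @^-1` _ = y @^-1` sublevel le x)//.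
apply: measurable_preimage_closed (sublevel_closed hpfx) => i j.
by rewrite ord1; exact: my.
Qed.

Lemma measurable_le_right (y : T -> 'rV[R]_d) : vmeasurable y ->
  measurable_fun setT (fun w => le x (y w)).
Proof.
move=> my; apply: (measurable_fun_bool false); rewrite setTI.
rewrite (_ : _ @^-1` _ = y @^-1` (sublevel le x)^°).
  apply: measurable_preimage_open (@open_interior _ _) => i j.
  by rewrite ord1; exact: my.
apply/seteqP; split => w /=; rewrite (le_interior le_complete hpfx).
  by move=> /negbFE/asboolP.
by move=> yi; apply/negbF/asboolP.
Qed.

Lemma measurable_prec (y : T -> 'rV[R]_d) : vmeasurable y ->
  measurable_fun setT (fun w => prec le x (y w)).
Proof.
move=> my; apply: measurable_and; first exact: measurable_le_right.
by apply: measurable_neg; exact: measurable_le_left.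
Qed.

Lemma vmeasurable_add_scale (a : T -> R) (u : T -> 'rV[R]_d) :
  measurable_fun setT a -> vmeasurable u ->
  vmeasurable (fun w => x + a w *: u w).
Proof.
by move=> ma mu; apply: vmeasurableD; [exact: vmeasurable_cst|exact: vmeasurableZ].
Qed.

Lemma vmeasurable_sub_scale (a : T -> R) (u : T -> 'rV[R]_d) :
  measurable_fun setT a -> vmeasurable u ->
  vmeasurable (fun w => x - a w *: u w).
Proof.
move=> ma mu; apply: vmeasurableD; first exact: vmeasurable_cst.
by apply: vmeasurableN; exact: vmeasurableZ.
Qed.

(** The events [E k] of stopping after exactly [k] halvings are measurable and cover termination,
    and on [E k] the final radius is [h w / 2 ^+ k]. *)
Lemma line_search_measurable (u : T -> 'rV[R]_d) (h : T -> R) :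
  vmeasurable u -> measurable_fun setT h ->
  exists (b : T -> bool) (g : T -> R),
  [/\ measurable_fun setT b, measurable_fun setT g
    & forall w, if b w then exists N, line_search le x (u w) (h w) = Some (g w, g w, N)
                else line_search le x (u w) (h w) = None].
Proof.
move=> mu mh.
have mhk k : measurable_fun setT (fun w => h w / 2 ^+ k).
  by apply: measurable_funM => //; exact: measurable_cst.
pose test w (k : nat) := prec le x (x + (h w / 2 ^+ k) *: u w)
               && prec le x (x - (h w / 2 ^+ k) *: u w).
have mtest k : measurable_fun setT (test^~ k).
  apply: measurable_and; apply: measurable_prec.
    exact: vmeasurable_add_scale.
  exact: vmeasurable_sub_scale.
have mset k : measurable [set w | test w k].
  by rewrite -[X in measurable X]setTI; exact: mtest.
pose E (k : nat) : set T := [set w | forall j, (j < k)%N -> test w j] `\` [set w | test w k].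
have mpre k : measurable [set w | forall j, (j < k)%N -> test w j].
  rewrite (_ : [set _ | _] = \bigcap_(j in `I_k) [set w | test w j]).
    exact: bigcap_measurableType.
  by apply/seteqP; split => w H j /=; exact: H.
have mE k : measurable (E k) by exact: measurableD.
pose b w := `[< exists k, ~~ test w k >].
pose g w := match pselect (exists k, ~~ test w k) with
            | left e => h w / 2 ^+ ex_minn e | right _ => 0 end.
have bE : [set w | b w] = \bigcup_k E k.
  apply/seteqP; split => w.
    move=> /asboolP e; case: (ex_minnP e) => k kt kmin.
    exists k => //; split; last by apply/negP.
    move=> j jk.
    by apply: contraT => /kmin; rewrite leqNgt jk.
  by move=> [k _ [_ /negP kt]]; apply/asboolP; exists k.
have gE k w : E k w -> g w = h w / 2 ^+ k.
  move=> [pre /negP kt]; rewrite /g; case: pselect => [e|]; last by case; exists k.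
  case: ex_minnP => j jt jmin; congr (_ / 2 ^+ _); apply/eqP.
  rewrite eqn_leq jmin// leqNgt; apply/negP => jk.
  by rewrite (pre _ jk) in jt.
have mb : measurable [set w | b w].
  by rewrite bE; exact: bigcup_measurable.
exists b, g; split.
- by apply: (measurable_fun_bool true); rewrite setTI.
- rewrite -(setUv [set w | b w]); apply/measurable_funU => //.
    exact: measurableC.
  split.
    rewrite bE; apply/measurable_fun_bigcup => // k.
    apply: (eq_measurable_fun (fun w => h w / 2 ^+ k)).
      by move=> w; rewrite inE => /gE ->.
    exact: measurable_funTS.
  apply: (eq_measurable_fun (fun _ : T => 0 : R)); last exact: measurable_cst.
  move=> w; rewrite inE => /= nb; rewrite /g; case: pselect => // e.
  by exfalso; apply: nb; exact/asboolP.
- move=> w; case: ifPn => [/asboolP e|/asboolPn e].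
    rewrite /line_search /g; case: pselect => // e'.
    by eexists.
  by rewrite /line_search; case: pselect.
Qed.

Lemma run_measurable_ret (f : T -> 'rV[R]_d) (h : T -> R) :
  vmeasurable f -> measurable_fun setT h ->
  run_measurable (fun w => cret (f w) (h w)).
Proof.
move=> mf mh; exists xpredT, f, h; split => //.
by move=> w; exists 0%N.
Qed.

Lemma run_measurable_if (b : T -> bool) F G :
  measurable_fun setT b -> run_measurable F -> run_measurable G ->
  run_measurable (fun w => if b w then F w else G w : option ('rV[R]_d * R * nat)).
Proof.
move=> mb [b1 [f1 [g1 [mb1 mf1 mg1 FE]]]] [b2 [f2 [g2 [mb2 mf2 mg2 GE]]]].
exists (fun w => if b w then b1 w else b2 w), (fun w => if b w then f1 w else f2 w).
exists (fun w => if b w then g1 w else g2 w); split.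
- exact: measurable_fun_ifT.
- exact: vmeasurable_if.
- exact: measurable_fun_ifT.
- by move=> w; case: (b w); [exact: FE|exact: GE].
Qed.

(** [K] receives [g] twice because the line search both returns the radius and stores it. *)
Lemma run_measurable_line_search (u : T -> 'rV[R]_d) (h : T -> R)
    (K : T -> R -> Defs.comp R 'rV[R]_d) :
  vmeasurable u -> measurable_fun setT h ->
  (forall g, measurable_fun setT g -> run_measurable (fun w => K w (g w) (g w))) ->
  run_measurable (fun w => cbind (line_search le x (u w)) (K w) (h w)).
Proof.
move=> mu mh mK; have [b [g [mb mg lsE]]] := line_search_measurable mu mh.
have [b2 [f2 [g2 [mb2 mf2 mg2 KE]]]] := mK _ mg.
exists (fun w => b w && b2 w), f2, g2; split => //.
  exact: measurable_and.
move=> w; have := lsE w; have := KE w; rewrite /cbind; case: (b w) => /=.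
  by case: (b2 w) => [[N KN] [M ->]|KN [M ->]]; rewrite KN//; eexists.
by move=> _ ->.
Qed.

Lemma run_measurable_bind (h : T -> R) (M : T -> Defs.comp R 'rV[R]_d)
    (K : T -> 'rV[R]_d -> Defs.comp R 'rV[R]_d) :
  run_measurable (fun w => M w (h w)) ->
  (forall f g, vmeasurable f -> measurable_fun setT g ->
     run_measurable (fun w => K w (f w) (g w))) ->
  run_measurable (fun w => cbind (M w) (K w) (h w)).
Proof.
move=> [b [f [g [mb mf mg ME]]]] mK.
have [b2 [f2 [g2 [mb2 mf2 mg2 KE]]]] := mK _ _ mf mg.
exists (fun w => b w && b2 w), f2, g2; split => //.
  exact: measurable_and.
move=> w; have := ME w; have := KE w; rewrite /cbind; case: (b w) => /=.
  by case: (b2 w) => [[N KN] [N' ->]|KN [N' ->]]; rewrite KN//; eexists.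
by move=> _ ->.
Qed.

Lemma bisection_measurable (T' : nat) (up um last : T -> 'rV[R]_d) (h : T -> R) :
  vmeasurable up -> vmeasurable um -> vmeasurable last -> measurable_fun setT h ->
  run_measurable (fun w => bisection le x T' (up w) (um w) (last w) (h w)).
Proof.
elim: T' up um last h => [|T' IH] up um last h mup mum mlast mh /=.
  exact: run_measurable_ret.
have muM : vmeasurable (fun w => (enorm (up w + um w))^-1 *: (up w + um w)).
  by apply: vmeasurableZ; [apply: measurable_enormV|]; exact: vmeasurableD.
apply: run_measurable_line_search => // g mg.
pose F w (c : bool) := (if c
  then bisection le x T' (up w) ((enorm (up w + um w))^-1 *: (up w + um w))
         ((enorm (up w + um w))^-1 *: (up w + um w))
  else bisection le x T' ((enorm (up w + um w))^-1 *: (up w + um w)) (um w)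
         ((enorm (up w + um w))^-1 *: (up w + um w))).
rewrite (_ : (fun w => _) = fun w =>
  if le (x + g w *: ((enorm (up w + um w))^-1 *: (up w + um w))) x
  then F w true (g w) else F w false (g w)).
  apply: run_measurable_if; [|exact: IH|exact: IH].
  by apply: measurable_le_left; exact: vmeasurable_add_scale.
by apply/funext => w; case: ifP.
Qed.

Lemma aplanar_measurable (T' : nat) (v q : T -> 'rV[R]_d) (th h : T -> R) :
  vmeasurable v -> vmeasurable q -> measurable_fun setT th ->
  measurable_fun setT h ->
  run_measurable (fun w => aplanar le x (v w) (q w) T' (th w) (h w)).
Proof.
move=> mv mq mth mh; rewrite /aplanar.
have mcos : measurable_fun setT (fun w => cos (th w)).
  exact: measurableT_comp measurable_cos mth.
have msin : measurable_fun setT (fun w => sin (th w)).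
  exact: measurableT_comp measurable_sin mth.
set abar := fun w => cos (th w) *: v w + sin (th w) *: q w.
have mabar : vmeasurable abar by exact: vmeasurable_dir.
set bbar := fun w => - sin (th w) *: v w + cos (th w) *: q w.
have mbbar : vmeasurable bbar.
  apply: vmeasurableD; apply: vmeasurableZ => //.
  exact: measurable_funN.
apply: (@run_measurable_line_search abar h) => // g mg.
have mp := vmeasurable_add_scale mg mabar.
have mm := vmeasurable_sub_scale mg mabar.
pose e w := (le (x + g w *: abar w) x && le (x - g w *: abar w) x)
  || (le x (x + g w *: abar w) && le x (x - g w *: abar w)).
have me : measurable_fun setT e.
  apply: measurable_or; apply: measurable_and;
    by [exact: measurable_le_left|exact: measurable_le_right].
pose p w := le (x + g w *: abar w) x.
have mpb : measurable_fun setT p by exact: measurable_le_left.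
pose up w := if p w then - abar w else abar w.
pose um w := if p w then abar w else - abar w.
have mup : vmeasurable up by apply: vmeasurable_if => //; exact: vmeasurableN.
have mum : vmeasurable um by apply: vmeasurable_if => //; exact: vmeasurableN.
pose K w h' := if le (x + h' *: bbar w) x
  then bisection le x T' (up w) (bbar w) (abar w)
  else bisection le x T' (bbar w) (um w) (abar w).
rewrite (_ : (fun w => _) = fun w => if e w then cret (abar w) (g w)
  else cbind (line_search le x (bbar w)) (K w) (g w)); last first.
  by apply/funext => w; rewrite /e /K /up /um /p /cbind; case: ifP.
apply: run_measurable_if => //; first exact: run_measurable_ret.
apply: run_measurable_line_search => // g2 mg2.
rewrite (_ : (fun w => _) = fun w => if le (x + g2 w *: bbar w) x
  then bisection le x T' (up w) (bbar w) (abar w) (g2 w)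
  else bisection le x T' (bbar w) (um w) (abar w) (g2 w)); last first.
  by apply/funext => w; rewrite /K; case: ifP.
apply: run_measurable_if; [|exact: bisection_measurable|exact: bisection_measurable].
by apply: measurable_le_left; exact: vmeasurable_add_scale.
Qed.

End run_measurability.

Section loop_measurability.
Context {disp : measure_display} {T : measurableType disp} {R : realType}.
Context {n : nat}.
Variables (le : rel 'rV[R]_n.+1) (x : 'rV[R]_n.+1).
Hypothesis le_complete : total le.
Hypothesis hpfx : plateau_free_at le x.
Variables (Q : T -> borel_mx R n.+1) (theta : 'I_n -> T -> R).
Hypothesis mQ : measurable_fun setT Q.

Lemma ane_loop_measurable (T' : nat) (s : seq 'I_n) (v : T -> 'rV[R]_n.+1) (h : T -> R) :
  (forall i, i \in s -> measurable_fun setT (theta i)) ->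
  vmeasurable v -> measurable_fun setT h ->
  run_measurable (fun w =>
    ane_loop le x T' (Q w : 'M[R]_n.+1) (fun i => theta i w) s (v w) (h w)).
Proof.
elim: s v h => [|i s IH] v h mth mv mh /=; first exact: run_measurable_ret.
have mq : vmeasurable (fun w => row (lift ord0 i) (Q w : 'M[R]_n.+1)).
  exact: vmeasurable_row.
apply: run_measurable_bind.
  by apply: aplanar_measurable => //; apply: mth; rewrite inE eqxx.
move=> y g my mg; apply: IH => //.
  by move=> j js; apply: mth; rewrite inE js orbT.
apply: vmeasurableD; apply: vmeasurableZ => //.
  by apply: measurable_funN; exact: measurable_dot.
exact: measurable_dot.
Qed.

(** Only angles of index below [i] are assumed measurable; this is what allows the sigma-algebra
    that ignores [theta i]. *)
Lemma prefix_dir_measurable (T' : nat) (h0 : R) (i : nat) :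
  (forall j : 'I_n, (j < i)%N -> measurable_fun setT (theta j)) ->
  vmeasurable (fun w =>
    prefix_dir le x T' (Q w : 'M[R]_n.+1) (fun j => theta j w) h0 i).
Proof.
move=> mth.
have [||b [f [g [mb mf mg FE]]]] :=
  @ane_loop_measurable T' (take i (enum 'I_n))
    (fun w => row ord0 (Q w : 'M[R]_n.+1)) (cst h0) _ _ (measurable_cst _).
- move=> j jt; apply: mth.
  have : index j (take i (enum 'I_n)) = j.
    rewrite -[RHS](index_enum_ord j) -[in RHS](cat_take_drop i (enum 'I_n)).
    by rewrite index_cat jt.
  move: jt; rewrite -index_mem => /leq_trans + <-; apply.
  by rewrite size_take_min geq_minl.
- exact: vmeasurable_row.
rewrite (_ : (fun w => _) = fun w => if b w then f w else 0).
  by apply: vmeasurable_if => //; exact: vmeasurable_cst.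
apply/funext => w; rewrite /prefix_dir /ane_prefix.
by have := FE w; case: (b w) => [[N ->]|->].
Qed.

Lemma frame_coords_measurable (beta : R) (l : seq ('I_n * nat)) :
  (forall i, measurable_fun setT (theta i)) ->
  vmeasurable (fun w => frame_coords (fun i => theta i w) beta l).
Proof.
move=> mth; elim: l => [|[i m] l IH] /=; first exact: vmeasurable_cst.
apply: vmeasurable_dir; [exact: IH|exact: vmeasurable_cst|].
apply: measurable_funD; last exact: measurable_cst.
by apply: measurable_funD => //; exact: measurable_cst.
Qed.

End loop_measurability.

(** * Sinusoids of a uniform angle *)

Section trigonometric_bounds.
Variable R : realType.
Implicit Types x y : R.

Lemma continuous_within_itv (f : R -> R) (a b : R) :
  continuous f -> {within `[a, b], continuous f}.
Proof. exact: continuous_subspaceT. Qed.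

Lemma sin_mean_value x y : x <= y ->
  exists c, [/\ x <= c, c <= y & sin y - sin x = cos c * (y - x)].
Proof.
move=> xy.
have [c] := @MVT_segment R sin cos x y xy (fun z _ => is_derive_sin z)
  (continuous_within_itv (@continuous_sin R)).
by rewrite in_itv/= => /andP[xc cy] E; exists c.
Qed.

Lemma sin_le_id x : 0 <= x -> sin x <= x.
Proof.
move=> x0; have [c [_ _]] := sin_mean_value x0.
rewrite sin0 !subr0 => ->; rewrite ler_piMl//; exact: cos_le1.
Qed.

Lemma cos_ge_quadratic x : 0 <= x -> x <= pi -> 1 - x ^+ 2 / 2 <= cos x.
Proof.
move=> x0 xpi; rewrite -[in leRHS](divfK (_ : 2 != 0) x)// mulr_natr cos_mulr2n.
have := cos2Dsin2 (x / 2).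
have s0 : 0 <= sin (x / 2) by apply: sin_ge0_pi; lra.
have := sin_le_id (_ : 0 <= x / 2); rewrite divr_ge0// => /(_ isT).
move: s0; set s := sin _; set c := cos _; move=> s0 sx cs.
have h : s ^+ 2 <= (x / 2) ^+ 2 by rewrite ler_sqr ?nnegrE//; lra.
lra.
Qed.

Lemma cos_le_mono x y : 0 <= x -> x <= y -> y <= pi -> cos y <= cos x.
Proof.
move=> x0; rewrite le_eqVlt => /orP[/eqP->//|xy] ypi.
by apply/ltW; rewrite ltr_cos ?in_itv/=; lra.
Qed.

(** Concavity of the sine: mean values on both sides of [x] compare the two slopes. *)
Lemma sin_ge_chord x : 0 <= x -> x <= pi / 2 -> x <= pi / 2 * sin x.
Proof.
move=> x0 xpi; have pi0 := pi_gt0 R.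
have [c [c0 cx]] := sin_mean_value x0; rewrite sin0 !subr0 => E1.
have [c' [xc' c'pi]] := sin_mean_value xpi; rewrite sin_pihalf => E2.
have cc' : cos c' <= cos c by apply: cos_le_mono; lra.
set s := sin x in E1 E2 *.
suff : 0 <= s * (pi / 2 - x) - x * (1 - s) by lra.
rewrite E2 E1; have -> : cos c * x * (pi / 2 - x) - x * (cos c' * (pi / 2 - x))
  = (cos c - cos c') * (x * (pi / 2 - x)) by ring.
by rewrite mulr_ge0 ?mulr_ge0//; lra.
Qed.

Lemma abs_sin_ge x : `|x| <= pi / 2 -> `|x| <= pi / 2 * `|sin x|.
Proof.
have [x0|x0] := leP 0 x; move=> hx.
  rewrite ger0_norm in hx => //; rewrite (ger0_norm x0).
  by rewrite ger0_norm ?sin_ge_chord// sin_ge0_pi//; have := pi_gt0 R; lra.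
rewrite ltr0_norm in hx => //; rewrite (ltr0_norm x0).
rewrite -normrN -sinN ger0_norm; last by rewrite sin_ge0_pi//; have := pi_gt0 R; lra.
by apply: sin_ge_chord; lra.
Qed.

(** If [7 / 2 < pi], then [cos (7 / 4)] is positive; but three duplications starting from a lower
    bound on [sin (7 / 32)] make it negative. *)
Lemma pi_le_7half : pi <= 7 / 2 :> R.
Proof.
rewrite leNgt; apply/negP => hpi.
have c4 : 0 < cos (7 / 4 : R) by apply: cos_gt0_pihalf; lra.
have c2 : 0 < cos (7 / 8 : R) by apply: cos_gt0_pihalf; lra.
have c1 : 0 < cos (7 / 16 : R) by apply: cos_gt0_pihalf; lra.
have E4 : cos (7 / 4 : R) = cos (7 / 8) ^+ 2 *+ 2 - 1.
  by rewrite -cos_mulr2n; congr cos; rewrite mulr2n; lra.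
have E2 : cos (7 / 8 : R) = cos (7 / 16) ^+ 2 *+ 2 - 1.
  by rewrite -cos_mulr2n; congr cos; rewrite mulr2n; lra.
have E1 : cos (7 / 16 : R) = cos (7 / 32) ^+ 2 *+ 2 - 1.
  by rewrite -cos_mulr2n; congr cos; rewrite mulr2n; lra.
have s : 21 / 100 <= sin (7 / 32 : R).
  have x0 : 0 <= 7 / 32 :> R by lra.
  have [c [c0 cx]] := sin_mean_value x0; rewrite sin0 !subr0 => ->.
  have cpi : c <= pi by lra.
  have := cos_ge_quadratic c0 cpi; nra.
have := cos2Dsin2 (7 / 32 : R); move: c1 c2 c4; rewrite E4 E2 E1 !mulr2n.
set C := cos (7 / 32); set S := sin (7 / 32) in s *; move=> c1 c2 c4 CS.
have hC : C ^+ 2 <= 1 - (21 / 100) ^+ 2 by nra.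
have h1 : C ^+ 2 + C ^+ 2 - 1 <= 912 / 1000 by lra.
set D := C ^+ 2 + C ^+ 2 - 1 in c1 c2 c4 h1.
have h2 : D ^+ 2 + D ^+ 2 - 1 <= 664 / 1000 by nra.
set E := D ^+ 2 + D ^+ 2 - 1 in c2 c4 h2.
nra.
Qed.

(* On [0, 2 pi[ the sinusoid vanishes near at most four points
   [psi + k pi], [-1 <= k <= 2], and is small only around them. *)
Lemma sinusoid_small_set (a g t rho : R) : 0 < rho -> rho ^+ 2 = a ^+ 2 + g ^+ 2 ->
  exists psi, forall x, 0 <= x -> x < 2 * pi ->
    `|a * cos x + g * sin x| < t ->
    exists2 k : nat, (k < 4)%N &
      `|x - (psi + (k%:R - 1) * pi)| <= pi / 2 * (t / rho).
Proof.
(* Changing both signs preserves the absolute value, and for [a <= 0] the phase is an [acos], whose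
   sine is nonnegative. *)
move=> rho0; wlog a0 : a g / a <= 0 => [hw|] E.
  have [a0|a0] := leP a 0; first exact: hw.
  have := hw (- a) (- g); rewrite !sqrrN => /(_ _ E)[|psi hpsi]; first lra.
  exists psi => x x0 x2 hx; apply: hpsi => //.
  by rewrite !mulNr -opprD normrN.
have grho : -1 <= g / rho <= 1.
  rewrite -ler_norml normrM normfV (gtr0_norm rho0) ler_pdivrMr// mul1r.
  rewrite -(@ler_pXn2r _ 2) ?nnegrE// ?(ltW rho0)//.
  by rewrite real_normK ?num_real// E lerDr sqr_ge0.
exists (acos (g / rho)) => x x0 x2.
have psi0 := acos_ge0 grho; have psipi := acos_lepi grho.
have gE : g = rho * cos (acos (g / rho)).
  by rewrite acosK ?in_itv/=// mulrC divfK// gt_eqF.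
have aE : a = - (rho * sin (acos (g / rho))).
  have s0 : 0 <= sin (acos (g / rho)) by apply: sin_ge0_pi; rewrite psi0.
  have s2 : (rho * sin (acos (g / rho))) ^+ 2 = (- a) ^+ 2.
    have := cos2Dsin2 (acos (g / rho)).
    have : g ^+ 2 = (rho * cos (acos (g / rho))) ^+ 2 by rewrite -gE.
    move: (sin _) (cos _) => S C; rewrite exprMn sqrrN => gC CS.
    have -> : a ^+ 2 = rho ^+ 2 * (C ^+ 2 + S ^+ 2) - g ^+ 2.
      by rewrite CS mulr1 E addrK.
    by rewrite gC; ring.
  apply/eqP; rewrite -eqr_opp opprK eq_sym; apply/eqP.
  apply: (pexpIrn (_ : (0 < 2)%N)) => //; rewrite nnegrE; last by rewrite oppr_ge0.
  by rewrite mulr_ge0// ltW.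
set psi := acos _ in psi0 psipi aE gE *; rewrite aE gE.
have -> : - (rho * sin psi) * cos x + rho * cos psi * sin x = rho * sin (x - psi).
  by rewrite sinB; ring.
rewrite normrM (gtr0_norm rho0) -ltr_pdivlMl// => hs.
have pi0 := pi_gt0 R.
have fin (k : nat) : (k < 4)%N -> `|sin (x - (psi + (k%:R - 1) * pi))| = `|sin (x - psi)| ->
    `|x - (psi + (k%:R - 1) * pi)| <= pi / 2 ->
    exists2 k : nat, (k < 4)%N & `|x - (psi + (k%:R - 1) * pi)| <= pi / 2 * (t / rho).
  move=> k4 sk xk; exists k => //; apply: le_trans (abs_sin_ge xk) _.
  by rewrite ler_wpM2l ?divr_ge0 ?(ltW pi0)// sk mulrC ltW// mulrC.
have sinBpi y : sin (y - pi) = - sin y.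
  by rewrite -[in RHS](subrK pi y) sinDpi opprK.
have [h1|h1] := leP (x - psi) (- (pi / 2)).
  apply: (fin 0%N) => //; last by rewrite ler_norml; lra.
  by rewrite (_ : x - _ = x - psi + pi) ?sinDpi ?normrN//; ring.
have [h2|h2] := leP (x - psi) (pi / 2).
  apply: (fin 1%N) => //; last by rewrite ler_norml; lra.
  by rewrite subrr mul0r addr0.
have [h3|h3] := leP (x - psi) (3 * pi / 2).
  apply: (fin 2%N) => //; last by rewrite ler_norml; lra.
  by rewrite (_ : x - _ = x - psi - pi) ?sinBpi ?normrN//; ring.
apply: (fin 3%N) => //; last by rewrite ler_norml; lra.
by rewrite (_ : x - _ = x - psi - pi - pi) ?sinBpi ?opprK//; ring.
Qed.

End trigonometric_bounds.

(** * Independence, Fubini and small values of a random sinusoid *)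

Section independence.
Context {disp : measure_display} {Omega : measurableType disp} {R : realType}.
Variable P : probability Omega R.
Local Open Scope ereal_scope.

(** The finite measures [P (_ & D)] and [P D * P] agree on the pi-system [G], hence on the
    sigma-algebra it generates. *)
Lemma indep_g_sigma (G : set (set Omega)) (D : set Omega) :
  G `<=` measurable -> setI_closed G -> G setT -> measurable D ->
  (forall E, G E -> P (E `&` D) = P E * P D) ->
  forall E, <<s G >> E -> P (E `&` D) = P E * P D.
Proof.
move=> Gm GI GT mD GE E sE.
have PDfin : P D \is a fin_num by exact: fin_num_measure.
have PD0 : (0 <= fine (P D))%R by apply: fine_ge0.
pose m2 := mscale (NngNum PD0) P.
suff : mrestr P mD E = m2 E by rewrite /m2 /mscale /mrestr /= => ->; rewrite fineK// muleC.
apply: (@g_sigma_algebra_measure_unique _ R Omega G Gm (fun=> setT) (fun=> GT)) => //.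
- by rewrite bigcup_const.
- move=> A /GE AD; change (P (A `&` D) = (fine (P D))%:E * P A).
  by rewrite AD fineK// muleC.
- move=> _; change (P (setT `&` D) < +oo); rewrite setTI.
  by apply: le_lt_trans (probability_le1 P mD) _; rewrite ltry.
Qed.

(** Independence makes the law of the pair the product law, so the probability is the integral of
    those of the sections, at most [k] on [E] and 0 elsewhere. *)
Lemma indep_fubini_le (d1 d2 : measure_display) (T1 : measurableType d1)
    (T2 : measurableType d2) (X : Omega -> T1) (Y : Omega -> T2) :
  measurable_fun setT X -> measurable_fun setT Y ->
  (forall A B, measurable A -> measurable B ->
     P (X @^-1` A `&` Y @^-1` B) = P (X @^-1` A) * P (Y @^-1` B)) ->
  forall (B : set (T1 * T2)) (E : set T1) (k : R), measurable B -> measurable E ->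
  (0 <= k)%R ->
  (forall x, E x -> P (Y @^-1` xsection B x) <= k%:E) ->
  (forall x, ~ E x -> P (Y @^-1` xsection B x) = 0) ->
  P [set w | B (X w, Y w)] <= k%:E * P (X @^-1` E).
Proof.
move=> mX mY XY B E k mB mE k0 hE hnE.
pose X' : {mfun Omega >-> T1} := HB.pack X (@isMeasurableFun.Build _ _ _ _ X mX).
pose Y' : {mfun Omega >-> T2} := HB.pack Y (@isMeasurableFun.Build _ _ _ _ Y mY).
have mXY : measurable_fun setT (fun w => (X w, Y w)) by exact: measurable_fun_pair.
pose Z : {mfun Omega >-> (T1 * T2)%type} :=
  HB.pack (fun w => (X w, Y w)) (@isMeasurableFun.Build _ _ _ _ _ mXY).
have <- : (distribution P X' \x distribution P Y') B = P [set w | B (X w, Y w)].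
  apply: (product_measure_unique (m' := distribution P Z)) => //.
  rewrite /product_measure1.
apply: (@le_trans _ _ (\int[distribution P X']_x (k%:E * (\1_E x)%:E))).
  apply: ge0_le_integral => //.
  - exact: measurable_fun_xsection.
  - apply: measurable_funeM; apply/measurable_EFinP; exact: measurable_indic.
  - move=> x _; rewrite indicE; case: (boolP (x \in E)) => [|/negP]; rewrite inE => Ex.
      by rewrite mule1; exact: hE.
    by rewrite mule0; have := hnE _ Ex; rewrite /distribution /pushforward /= => ->.
rewrite ge0_integralZl//; last by apply/measurable_EFinP; exact: measurable_indic.
by rewrite integral_indic// setIT.
Qed.

(** The shift [c] changes the coefficients but not the amplitude [rho >= sigma]. Four intervals of
    length [pi * (t / rho)], divided by [2 * pi], give [2 * (t / rho)]. *)
Lemma uniform_sinusoid_le (theta : {RV P >-> R}) (a g t sigma c : R) :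
  uniform_angle theta -> (0 < t)%R -> (0 < sigma)%R -> (sigma <= `|g|)%R ->
  P [set w | (`|a * cos (theta w + c) + g * sin (theta w + c)| < t)%R]
    <= (2 * (t / sigma))%:E.
Proof.
move=> utheta t0 sigma0 sg.
pose a' := (a * cos c + g * sin c)%R; pose g' := (g * cos c - a * sin c)%R.
have E x : (a * cos (x + c) + g * sin (x + c) = a' * cos x + g' * sin x)%R.
  by rewrite cosD sinD /a' /g'; ring.
pose rho := Num.sqrt (a' ^+ 2 + g' ^+ 2).
have sumE : (a' ^+ 2 + g' ^+ 2 = a ^+ 2 + g ^+ 2)%R.
  rewrite /a' /g' -[RHS]mulr1 -(cos2Dsin2 c); ring.
have rhoge : (sigma <= rho)%R.
  rewrite /rho sumE; apply: (le_trans sg); rewrite -sqrtr_sqr ler_sqrt.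
    by rewrite lerDr sqr_ge0.
  by rewrite addr_ge0 ?sqr_ge0.
have rho0 : (0 < rho)%R by apply: lt_le_trans rhoge.
have rho2 : (rho ^+ 2 = a' ^+ 2 + g' ^+ 2)%R.
  by rewrite /rho sqr_sqrtr// addr_ge0 ?sqr_ge0.
pose S := [set x : R | (`|a' * cos x + g' * sin x| < t)%R].
have mS : measurable S.
  have mf : measurable_fun setT (fun x : R => `|a' * cos x + g' * sin x|%R).
    apply: (measurableT_comp (@normr_measurable R setT)).
    by apply: measurable_funD; apply: measurable_funM;
      [exact: measurable_cst|exact: measurable_cos
      |exact: measurable_cst|exact: measurable_sin].
  rewrite (_ : S = (fun x : R => `|a' * cos x + g' * sin x|%R) @^-1` `]-oo, t[%classic).
    by rewrite -[X in measurable X]setTI; exact: mf.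
  by apply/seteqP; split => x; rewrite /= in_itv.
have -> : [set w | (`|a * cos (theta w + c) + g * sin (theta w + c)| < t)%R]
    = theta @^-1` S.
  by apply/seteqP; split => w; rewrite /S /= E.
rewrite -[P _]/(distribution P theta S) (utheta S mS).
have [psi hpsi] := sinusoid_small_set t rho0 rho2.
pose w := (pi / 2 * (t / rho))%R.
pose I (k : nat) := `[(psi + (k%:R - 1) * pi - w)%R, (psi + (k%:R - 1) * pi + w)%R]%classic.
have pi0 := pi_gt0 R.
have w0 : (0 < w)%R by rewrite /w !mulr_gt0// ?invr_gt0.
have leb : lebesgue_measure (S `&` `[0%R, (2 * pi)%R[) <= (8 * w)%:E.
  apply: (@le_trans _ _ (lebesgue_measure (\big[setU/set0]_(k < 4) I k))).
    apply: le_measure; rewrite ?inE.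
    - by apply: measurableI => //; exact: measurable_itv.
    - by apply: bigsetU_measurable => k _; exact: measurable_itv.
    - move=> x [/= Sx]; rewrite in_itv/= => /andP[x0 x2].
      have [k k4 xk] := hpsi x x0 x2 Sx.
      rewrite -bigcup_mkord; exists k => //=; rewrite /I /= in_itv/=.
      by move: xk; rewrite -/w ler_norml => /andP[? ?]; apply/andP; split; lra.
  apply: le_trans (le_mu_bigsetU _ _) _.
    by move=> k _; exact: measurable_itv.
  rewrite (eq_bigr (fun=> (2 * w)%:E)); last first.
    move=> k _; etransitivity; first exact: lebesgue_measure_itv.
    rewrite /= lte_fin ifT; last by lra.
    by rewrite -EFinD; congr EFin; ring.
  by rewrite !big_ord_recr big_ord0 /= add0e -!EFinD lee_fin; lra.
apply: (@le_trans _ _ (((2 * pi)^-1)%:E * (8 * w)%:E)).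
  by rewrite lee_pmul2l// lte_fin invr_gt0 mulr_gt0.
rewrite -EFinM lee_fin.
rewrite (_ : (2 * pi)^-1 * (8 * w) = 2 * (t / rho))%R; last first.
  have gen (p r : R) : (p != 0 -> r != 0 ->
      (2 * p)^-1 * (8 * (p / 2 * (t / r))) = 2 * (t / r))%R.
    by move=> p0 r0; field; rewrite p0 r0.
  by apply: gen; rewrite gt_eqF.
by rewrite ler_pM2l// ler_pM2l// lef_pV2.
Qed.

End independence.

(** * The Haar frame *)

Section haar.
Context {disp : measure_display} {Omega : measurableType disp} {R : realType}.
Variables (P : probability Omega R) (d : nat).
Variable Q : {RV P >-> borel_mx R d}.
Hypothesis hQ : haar_frame Q.

Let mQ : measurable_fun setT (Q : Omega -> borel_mx R d).
Proof. exact: measurable_funPT. Qed.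

Lemma borel_mx_preimage (D : set (borel_mx R d)) (disp' : measure_display)
    (T : measurableType disp') (F : T -> 'M[R]_d) :
  (forall i j, measurable_fun setT (fun w => F w i j)) -> measurable D ->
  measurable (F @^-1` D).
Proof.
move=> mF mD; rewrite -[X in measurable X]setTI.
exact: (measurable_borel_mx mF).
Qed.

Lemma measurable_mulmx_entry (disp' : measure_display) (T : measurableType disp')
    (F G : T -> 'M[R]_d) :
  (forall i j, measurable_fun setT (fun w => F w i j)) ->
  (forall i j, measurable_fun setT (fun w => G w i j)) ->
  forall i j, measurable_fun setT (fun w => (F w *m G w) i j).
Proof.
move=> mF mG i j; under eq_fun do rewrite mxE.
by apply: measurable_sum => k; apply: measurable_funM.
Qed.

Lemma haar_mulr (A : 'M[R]_d) (D : set (borel_mx R d)) :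
  orthogonal_mx A -> measurable D ->
  P [set w | D ((Q w : 'M[R]_d) *m A)] = P [set w | D (Q w)].
Proof. by move=> oA mD; exact: (hQ.2 A oA D mD). Qed.

(* [B *m Q *m Q'^T] with [Q'] an independent copy of [Q] is distributed as
   [B *m Q] for fixed [Q'] and as [Q'^T] for fixed [Q]. *)
Lemma haar_mull_tr (B : 'M[R]_d) (D : set (borel_mx R d)) :
  orthogonal_mx B -> measurable D ->
  P [set w | D (B *m (Q w : 'M[R]_d))] = P [set w | D ((Q w : 'M[R]_d)^T)].
Proof.
move=> oB mD.
pose S : set (Omega * Omega) :=
  [set z | D (B *m (Q z.1 : 'M[R]_d) *m (Q z.2 : 'M[R]_d)^T)].
have mS : measurable S.
  apply: (@borel_mx_preimage D _ (Omega * Omega)%type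
    (fun z => B *m (Q z.1 : 'M[R]_d) *m (Q z.2 : 'M[R]_d)^T)) => //.
  apply: measurable_mulmx_entry.
    apply: measurable_mulmx_entry => i j; first exact: measurable_cst.
    by apply: measurable_borel_entry; exact: measurableT_comp mQ measurable_fst.
  move=> i j; under eq_fun do rewrite mxE.
  by apply: measurable_borel_entry; exact: measurableT_comp mQ measurable_snd.
have mI : measurable_fun setT (fun M : borel_mx R d => M) by exact: measurable_id.
have mT : measurable ([set M | D M^T] : set (borel_mx R d)).
  apply: (@borel_mx_preimage D _ (borel_mx R d) (fun M : 'M[R]_d => M^T)) => // i j.
  by under eq_fun do rewrite mxE; exact: measurable_borel_entry mI.
have mB : measurable ([set M | D (B *m M)] : set (borel_mx R d)).
  apply: (@borel_mx_preimage D _ (borel_mx R d) (fun M : 'M[R]_d => B *m M)) => //.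
  apply: measurable_mulmx_entry => i j; first exact: measurable_cst.
  exact: measurable_borel_entry mI.
have E := @product_measure_unique _ _ _ _ R P P (P \x^ P)%E
  (fun A1 A2 mA1 mA2 => product_measure2E P P mA1 mA2) S mS.
have E1 : (P \x P)%E S = P [set w | D ((Q w : 'M[R]_d)^T)].
  rewrite /product_measure1.
  transitivity (\int[P]_w cst (P [set w | D ((Q w : 'M[R]_d)^T)]) w)%E; last first.
    rewrite integral_cst//; etransitivity; last exact: mule1.
    by congr (_ * _)%E; exact: probability_setT.
  apply: eq_integral.
  move=> w _ /=.
  have oA : orthogonal_mx (B *m (Q w : 'M[R]_d))^T.
    by apply: orthogonal_mx_tr; apply: orthogonal_mx_mul => //; exact: hQ.1.
  rewrite -[RHS](haar_mulr oA mT); congr (P _).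
  by apply/seteqP; split => w'; rewrite /xsection /S /= inE /= trmx_mul trmxK.
have E2 : (P \x^ P)%E S = P [set w | D (B *m (Q w : 'M[R]_d))].
  rewrite /product_measure2.
  transitivity (\int[P]_w cst (P [set w | D (B *m (Q w : 'M[R]_d))]) w)%E; last first.
    rewrite integral_cst//; etransitivity; last exact: mule1.
    by congr (_ * _)%E; exact: probability_setT.
  apply: eq_integral.
  move=> w _ /=.
  have oA : orthogonal_mx (Q w : 'M[R]_d)^T by apply: orthogonal_mx_tr; exact: hQ.1.
  rewrite -[RHS](haar_mulr oA mB); congr (P _).
  by apply/seteqP; split => w'; rewrite /ysection /S /= inE /= mulmxA.
by rewrite -E1 -E2 E.
Qed.

(** The right-hand side of [haar_mull_tr] does not involve [B], which can thus be compared with the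
    identity. *)
Lemma haar_mull (B : 'M[R]_d) (D : set (borel_mx R d)) :
  orthogonal_mx B -> measurable D ->
  P [set w | D (B *m (Q w : 'M[R]_d))] = P [set w | D (Q w)].
Proof.
move=> oB mD; rewrite haar_mull_tr//.
have o1 : orthogonal_mx (1%:M : 'M[R]_d) by rewrite /orthogonal_mx trmx1 mulmx1.
rewrite -(haar_mull_tr o1 mD); congr (P _).
by apply/seteqP; split => w /=; rewrite mul1mx.
Qed.

(** Some orthogonal [B] has [a] as its row [i], and then [a *m Q] is row [i] of [B *m Q]. *)
Lemma haar_row (a : 'rV[R]_d) (i : 'I_d) (U : set 'rV[R]_d) :
  dot a a = 1 -> measurable ([set M | U (row i M)] : set (borel_mx R d)) ->
  P [set w | U (a *m (Q w : 'M[R]_d))] = P [set w | U (row i (Q w : 'M[R]_d))].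
Proof.
move=> a1 mU.
have [||B oB aB] := @exists_orthogonal_mx R d (delta_mx 0 i) a => //.
  by rewrite dot_delta mxE !eqxx.
rewrite -(haar_mull oB mU); congr (P _).
by apply/seteqP; split => w /=; rewrite row_mul [row i B]rowE aB.
Qed.

Lemma haar_row_direction (i : 'I_d) (u v : 'rV[R]_d) (s : R) :
  dot u u = 1 -> dot v v = 1 ->
  P [set w | `|dot (row i (Q w : 'M[R]_d)) u| < s] =
  P [set w | `|dot (row i (Q w : 'M[R]_d)) v| < s].
Proof.
move=> u1 v1; have [A oA uA] := exists_orthogonal_mx u1 v1.
pose D : set (borel_mx R d) := [set M | `|dot (row i M) u| < s].
have mD : measurable D.
  have mf : measurable_fun setT (fun M : borel_mx R d => `|dot (row i M) u|).
    apply: (measurableT_comp (@normr_measurable R setT)).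
    apply: measurable_dot; last exact: vmeasurable_cst.
    move=> j; under eq_fun do rewrite mxE.
    have mI : measurable_fun setT (fun M : borel_mx R d => M) by exact: measurable_id.
    exact: measurable_borel_entry mI.
  rewrite (_ : D = (fun M : borel_mx R d => `|dot (row i M) u|) @^-1` `]-oo, s[%classic).
    by rewrite -[X in measurable X]setTI; exact: mf.
  by apply/seteqP; split => M; rewrite /D /= in_itv.
have oAT := orthogonal_mx_tr oA.
rewrite -[LHS]/(P [set w | D (Q w)]) -(haar_mulr oAT mD); congr (P _).
by apply/seteqP; split => w; rewrite /D /= row_mul dot_mulmxr trmxK uA.
Qed.

End haar.

(** * Grid counting and anticoncentration of a frame vector *)

Section grid.
Variables (R : realType) (d N : nat).
Local Notation M := (N.+1 * 2)%N.
Implicit Types k : {ffun 'I_d -> 'I_M}.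

(* The grid of vectors with odd integer coordinates in ]-M, M[; [M] is even so
   that 0 is not among them. *)
Definition grid_vector k : 'rV[R]_d := \row_j ((k j).*2.+1%:R - M%:R).

Lemma grid_entry_bounds (m : 'I_M) :
  (m.*2.+1%:R - M%:R != 0 :> R) /\ `|m.*2.+1%:R - M%:R : R| <= M%:R.
Proof.
split; first by rewrite subr_eq0 eqr_nat; apply/negP => /eqP; lia.
rewrite ler_norml; have := ltn_ord m => mM; apply/andP; split.
  by rewrite lerBrDr addrC subrr ler0n.
by rewrite lerBlDr -natrD ler_nat; lia.
Qed.

Lemma enorm_grid_vector k : enorm (grid_vector k) <= Num.sqrt d%:R * M%:R.
Proof.
rewrite enorm_le ?mulr_ge0 ?sqrtr_ge0// exprMn sqr_sqrtr//.
rewrite /dot -[X in X%:R * _](card_ord d) -sum1_card natr_sum mulr_suml.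
apply: ler_sum => j _; rewrite mul1r mxE -expr2.
rewrite -real_normK ?num_real//; have [_ h] := grid_entry_bounds (k j).
by rewrite ler_pXn2r ?nnegrE.
Qed.

Lemma enorm_grid_vector_gt0 (j : 'I_d) k : 0 < enorm (grid_vector k).
Proof.
rewrite sqrtr_gt0 lt_neqAle dot_ge0 andbT eq_sym; apply/negP => /eqP/dot_eq0.
move=> /rowP/(_ j); rewrite !mxE; have [h _] := grid_entry_bounds (k j).
by move/eqP; rewrite (negbTE h).
Qed.

Lemma card_spread (A : {set 'I_M}) (L : R) : 0 <= L ->
  (forall m m', m \in A -> m' \in A -> m'%:R - m%:R <= L :> R) ->
  #|A|%:R <= L + 1.
Proof.
move=> L0 hA; have [->|[a0 a0A]] := set_0Vmem A.
  by rewrite cards0 addr_ge0.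
pose a := [arg min_(m < a0 in A) (m : nat)]; pose b := [arg max_(m > a0 in A) (m : nat)].
have [aA amin] : a \in A /\ forall m, m \in A -> (a <= m)%N.
  by rewrite /a; case: arg_minnP.
have [bA bmax] : b \in A /\ forall m, m \in A -> (m <= b)%N.
  by rewrite /b; case: arg_maxnP.
have ab := amin _ bA.
have : (#|A| <= (b - a).+1)%N.
  rewrite cardE -(size_map val) -(size_iota a (b - a).+1).
  apply: uniq_leq_size; first by rewrite map_inj_uniq ?enum_uniq//; exact: val_inj.
  move=> _ /mapP[m + ->]; rewrite mem_enum => mA; rewrite mem_iota.
  by have := amin _ mA; have := bmax _ mA; move: ab => /=; lia.
rewrite -(ler_nat R) => /le_trans; apply.
by rewrite -natr1 lerD2r natrB//; exact: hA.
Qed.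

(** Some coordinate of [q] is at least [1 / sqrt d] in absolute value. Once the other coordinates of
    the grid vector are frozen, which can be done in [M ^ (d - 1)] ways, near-orthogonality confines
    the index of this one to a spread of [s * d * M]. *)
Lemma card_grid_near_hyperplane (q : 'rV[R]_d) (s : R) : 0 < s ->
  dot q q = 1 ->
  #|[pred k | `|dot q (grid_vector k)| < s * enorm (grid_vector k)]|%:R
    <= M%:R ^+ d.-1 * (s * d%:R * M%:R + 1) :> R.
Proof.
move=> s0 q1; set S := [pred k | _].
have d0 : (0 < d)%N.
  case: (posnP d) => // dd.
  have : dot q q = 0 by rewrite /dot big1// => -[i id]; exfalso; move: id; rewrite dd.
  by rewrite q1 => /eqP; rewrite oner_eq0.
have [j qj] : exists j, 1 <= Num.sqrt d%:R * `|q 0 j|.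
  apply/existsP; apply: contraT; rewrite negb_exists => /forallP hq.
  have : dot q q < \sum_(j < d) d%:R^-1.
    rewrite /dot; apply: ltr_sum.
      by apply/hasP; exists (Ordinal d0); rewrite ?mem_index_enum.
    move=> j _; have := hq j; rewrite -ltNge => hj.
    rewrite -expr2 -real_normK ?num_real// -(@ltr_pM2l _ d%:R) ?ltr0n//.
    rewrite divff ?pnatr_eq0 -?lt0n//.
    rewrite -[X in X * _](@sqr_sqrtr _ d%:R)// -exprMn.
    by rewrite expr_lt1// mulr_ge0.
  by rewrite q1 sumr_const card_ord -[_ *+ d]mulr_natr mulVf ?ltxx// pnatr_eq0 -lt0n.
have sd0 : 0 < Num.sqrt d%:R :> R by rewrite sqrtr_gt0 ltr0n.
have qj0 : 0 < `|q 0 j|.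
  by rewrite -(pmulr_rgt0 _ sd0); exact: lt_le_trans qj.
pose f k : {ffun {l : 'I_d | l != j} -> 'I_M} := [ffun l => k (val l)].
have inj_f k1 k2 : f k1 = f k2 -> k1 j = k2 j -> k1 = k2.
  move=> /ffunP fE jE; apply/ffunP => l; have [->//|lj] := eqVneq l j.
  by have := fE (exist _ l lj); rewrite !ffunE.
rewrite -sum1_card (partition_big f xpredT)//= natr_sum.
rewrite (_ : M%:R ^+ d.-1 * _ = \sum_(y : {ffun {l : 'I_d | l != j} -> 'I_M})
    (s * d%:R * M%:R + 1)); last first.
  rewrite sumr_const card_ffun card_ord card_sig.
  rewrite (eq_card (B := predC1 j)); last by move=> l; rewrite !inE.
  by rewrite cardC1 card_ord -[RHS]mulr_natl natrX.
apply: ler_sum => y _; rewrite sum1_card.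
set F := (X in #|X|).
have -> : #|F| = #|(fun k : {ffun 'I_d -> 'I_M} => k j) @: F|.
  apply/esym; apply: card_in_imset => k1 k2; rewrite /in_mem /= => /andP[_ /eqP f1] /andP[_ /eqP f2].
  by apply: inj_f; rewrite f1 f2.
apply: card_spread; first by rewrite !mulr_ge0// ltW.
move=> _ _ /imsetP[k1 k1F ->] /imsetP[k2 k2F ->].
move: k1F k2F; rewrite /in_mem /= => /andP[S1 /eqP f1] /andP[S2 /eqP f2].
rewrite /S !inE in S1 S2.
have b1 := lt_le_trans S1 (ler_wpM2l (ltW s0) (enorm_grid_vector k1)).
have b2 := lt_le_trans S2 (ler_wpM2l (ltW s0) (enorm_grid_vector k2)).
have diff : dot q (grid_vector k2) - dot q (grid_vector k1) =
    q 0 j * (2 * ((k2 j)%:R - (k1 j)%:R)).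
  rewrite -dotBr /dot (bigD1 j)//= big1 ?addr0 => [|l lj].
    by rewrite !mxE -!natr1 -!muln2 !natrM; ring.
  have : f k1 = f k2 by rewrite f1.
  by move=> /ffunP/(_ (exist _ l lj)); rewrite !ffunE !mxE /= => ->; rewrite subrr mulr0.
have [k12|k12] := leP ((k2 j)%:R - (k1 j)%:R : R) 0.
  by apply: (le_trans k12); rewrite !mulr_ge0// ltW.
have : `|q 0 j * (2 * ((k2 j)%:R - (k1 j)%:R))| <= 2 * (s * (Num.sqrt d%:R * M%:R)).
  rewrite -diff; apply: (le_trans (ler_normB _ _)); lra.
rewrite normrM (gtr0_norm (_ : 0 < 2 * _)) ?mulr_gt0//.
set D := _ - _ in k12 *; set m := M%:R in b1 b2 *.
have m0 : 0 <= m by rewrite ler0n.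
move=> h; rewrite -(@sqr_sqrtr _ d%:R) ?ler0n// expr2.
set r := Num.sqrt _ in sd0 qj h *.
have h1 : D <= r * (`|q 0 j| * D) by rewrite mulrA ler_peMl// ltW.
apply: (le_trans h1).
rewrite (_ : s * (r * r) * m = r * (s * (r * m))); last by ring.
by rewrite ler_wpM2l ?(ltW sd0)//; lra.
Qed.

End grid.

Section anticoncentration.
Context {disp : measure_display} {Omega : measurableType disp} {R : realType}.
Variables (P : probability Omega R) (d : nat).
Variable Q : {RV P >-> borel_mx R d}.
Hypothesis hQ : haar_frame Q.

Lemma measurable_row_dot_lt (i : 'I_d) (v : 'rV[R]_d) (s : R) :
  measurable [set w | `|dot (row i (Q w : 'M[R]_d)) v| < s].
Proof.
have mf : measurable_fun setT (fun w => `|dot (row i (Q w : 'M[R]_d)) v|).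
  apply: (measurableT_comp (@normr_measurable R setT)).
  apply: measurable_dot; last exact: vmeasurable_cst.
  by apply: vmeasurable_row; exact: measurable_funPT.
rewrite (_ : [set w | _] = (fun w => `|dot (row i (Q w : 'M[R]_d)) v|) @^-1` `]-oo, s[%classic).
  by rewrite -[X in measurable X]setTI; exact: mf.
by apply/seteqP; split => w; rewrite /= in_itv.
Qed.

(* All directions [v] give the same probability; average it over a fine grid of
   directions, few of which can be almost orthogonal to a given row. *)
Lemma haar_anticoncentration (i : 'I_d) (v : 'rV[R]_d) (s : R) :
  0 < s -> dot v v = 1 ->
  (P [set w | (`|dot (row i (Q w : 'M[R]_d)) v| < s)%R] <= (s * d%:R)%:E)%E.
Proof.
move=> s0 v1; set p := P _.
have mp : measurable [set w | `|dot (row i (Q w : 'M[R]_d)) v| < s].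
  exact: measurable_row_dot_lt.
have pfin : p \is a fin_num by exact: fin_num_measure.
rewrite -(fineK pfin) lee_fin; set p' := fine p.
(* The grid costs an additive [1 / M], which vanishes under refinement. *)
suff bound N : p' <= s * d%:R + (N.+1 * 2)%:R^-1.
  rewrite leNgt; apply/negP => gap.
  have e0 : 0 < p' - s * d%:R by rewrite subr_gt0.
  have := archi_boundP (ltW (_ : 0 < (p' - s * d%:R)^-1)).
  rewrite invr_gt0 => /(_ e0); set N := Num.bound _ => hN.
  have a0 : (0 : R) < (N.+1 * 2)%:R by rewrite ltr0n.
  have : (p' - s * d%:R)^-1 < (N.+1 * 2)%:R.
    by apply: (lt_trans hN); rewrite ltr_nat; lia.
  rewrite -[ltRHS]invrK ltf_pV2 ?posrE ?invr_gt0// ltrBrDl.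
  by move=> /(le_lt_trans (bound N)); rewrite ltxx.
pose E (k : {ffun 'I_d -> 'I_(N.+1 * 2)}) := [set w |
  `|dot (row i (Q w : 'M[R]_d)) (grid_vector R k)| < s * enorm (grid_vector R k)].
have EP k : P (E k) = p.
  have n0 := enorm_grid_vector_gt0 R i k.
  pose u := (enorm (grid_vector R k))^-1 *: grid_vector R k.
  have u1 : dot u u = 1.
    by rewrite /u dotZl dotZr -enorm_sqr; field; rewrite gt_eqF.
  rewrite /p (haar_row_direction hQ i s v1 u1); congr (P _).
  apply/seteqP; split => w; rewrite /E /u /= dotZr normrM normfV (gtr0_norm n0);
    by rewrite ltr_pdivrMl// mulrC.
have mE k : measurable (E k) by exact: measurable_row_dot_lt.
have sumE : (\sum_(k : {ffun 'I_d -> 'I_(N.+1 * 2)}) P (E k) <=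
    ((N.+1 * 2)%:R ^+ d.-1 * (s * d%:R * (N.+1 * 2)%:R + 1))%:E)%E.
  rewrite (eq_bigr (fun k => \int[P]_w (\1_(E k) w)%:E)%E); last first.
    by move=> k _; rewrite integral_indic// setIT.
  rewrite -ge0_integral_sum//; last first.
    by move=> k; apply/measurable_EFinP; exact: measurable_indic.
  set c := (_ * _)%R.
  apply: (@le_trans _ _ (\int[P]_w (cst c%:E w))%E); last first.
    rewrite integral_cst// [X in (_ * X)%E](_ : _ = 1%E) ?mule1//.
    exact: probability_setT.
  apply: ge0_le_integral => //.
  - by move=> w _; apply: sume_ge0.
  - by apply: emeasurable_sum => k; apply/measurable_EFinP; exact: measurable_indic.
  move=> w _; rewrite sumEFin lee_fin.
  have q1 : dot (row i (Q w : 'M[R]_d)) (row i (Q w : 'M[R]_d)) = 1.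
    by rewrite dot_row ?eqxx//; exact: hQ.1.
  apply: le_trans (card_grid_near_hyperplane N s0 q1).
  rewrite -sum1_card natr_sum [leRHS]big_mkcond /=.
  apply: ler_sum => k _; rewrite indicE.
  by case: (boolP (w \in _)) => [|_]; [rewrite inE /E inE /= => ->|case: ifP].
move: sumE; rewrite (eq_bigr (fun=> p'%:E)); last by move=> k _; rewrite EP fineK.
rewrite sumEFin lee_fin sumr_const card_ffun !card_ord -[leLHS]mulr_natr natrX.
have a0 : (0 : R) < (N.+1 * 2)%:R by rewrite ltr0n.
set a := (N.+1 * 2)%:R in a0 *.
have d0 : (0 < d)%N by apply: leq_trans (ltn_ord i).
have -> : a ^+ d = a ^+ d.-1 * a by rewrite -exprSr prednK.
rewrite mulrCA ler_pM2l ?exprn_gt0// => h.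
by rewrite -(ler_pM2r a0) (le_trans h)// mulrDl mulVf ?gt_eqF.
Qed.

End anticoncentration.

(** * Independence of the draws *)

Section draws.
Context {disp : measure_display} {Omega : measurableType disp} {R : realType}.
Variables (P : probability Omega R) (n : nat).
Variables (Q : {RV P >-> borel_mx R n.+1}) (theta : 'I_n -> {RV P >-> R}).
Hypothesis hind : independent_draws Q theta.

Definition angle_cylinders : set (set Omega) :=
  [set E | exists A : 'I_n -> set R, (forall j, measurable (A j)) /\
     E = [set w | forall j, A j (theta j w)]].

Definition draw_cylinders (i : 'I_n) : set (set Omega) :=
  [set E | exists (B : set (borel_mx R n.+1)) (A : 'I_n -> set R),
     [/\ measurable B, forall j, measurable (A j), A i = setT &
         E = (Q @^-1` B) `&` [set w | forall j, A j (theta j w)]]].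

(* The sigma-algebras of the angles, and of all the draws but [theta i]. *)
Notation angle_space := (g_sigma_algebraType angle_cylinders).
Notation draw_space i := (g_sigma_algebraType (draw_cylinders i)).

Lemma measurable_angle_event (A : 'I_n -> set R) :
  (forall j, measurable (A j)) -> measurable [set w | forall j, A j (theta j w)].
Proof.
move=> mA; rewrite (_ : [set w | _] = \bigcap_(j in [set: 'I_n]) (theta j @^-1` A j)).
  apply: fin_bigcap_measurable => // j _; rewrite -[X in measurable X]setTI.
  exact: measurable_funPT.
by apply/seteqP; split => w /= h j; [move=> _; exact: h|exact: (h j Logic.I)].
Qed.

Lemma measurable_frame_event (B : set (borel_mx R n.+1)) :
  measurable B -> measurable (Q @^-1` B).
Proof. by move=> mB; rewrite -[X in measurable X]setTI; exact: measurable_funPT. Qed.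

Lemma angle_cylinders_measurable : angle_cylinders `<=` measurable.
Proof. by move=> _ [A [mA ->]]; exact: measurable_angle_event. Qed.

Lemma draw_cylinders_measurable i : draw_cylinders i `<=` measurable.
Proof.
move=> _ [B [A [mB mA _ ->]]]; apply: measurableI.
  exact: measurable_frame_event.
exact: measurable_angle_event.
Qed.

Lemma angle_cylindersI : setI_closed angle_cylinders.
Proof.
move=> _ _ [A [mA ->]] [B [mB ->]]; exists (fun j => A j `&` B j); split.
  by move=> j; exact: measurableI.
apply/seteqP; split => [w [h1 h2] j|w h]; first by split; [exact: h1|exact: h2].
by split=> j; [exact: (h j).1|exact: (h j).2].
Qed.

Lemma draw_cylindersI i : setI_closed (draw_cylinders i).
Proof.
move=> _ _ [B [A [mB mA Ai ->]]] [B' [A' [mB' mA' Ai' ->]]].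
exists (B `&` B'), (fun j => A j `&` A' j); split.
- exact: measurableI.
- by move=> j; exact: measurableI.
- by rewrite Ai Ai' setTI.
apply/seteqP; split => [w [[h1 h2] [h3 h4]]|w [[h1 h2] h]].
  by split; [split|move=> j; exact: (conj (h2 j) (h4 j))].
by do 2 split => //; move=> j; [exact: (h j).1|exact: (h j).2].
Qed.

Lemma indep_angles_frame (E : set Omega) (B : set (borel_mx R n.+1)) :
  <<s angle_cylinders >> E -> measurable B ->
  (P (E `&` Q @^-1` B) = P E * P (Q @^-1` B))%E.
Proof.
move=> sE mB; apply: (indep_g_sigma angle_cylinders_measurable angle_cylindersI) sE.
- exists (fun=> setT); split; first by move=> j; exact: measurableT.
  by apply/seteqP; split.
- exact: measurable_frame_event.
- move=> _ [A [mA ->]]; rewrite setIC (hind mB mA) muleC; congr (_ * _)%E.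
  have := hind measurableT mA; rewrite preimage_setT setTI => ->.
  by rewrite [P setT]probability_setT mul1e.
Qed.

(** The slot [i] of a cylinder is free, so a condition on [theta i] can be placed there and factored
    out by the product formula. *)
Lemma indep_draws_angle (i : 'I_n) (E : set Omega) (D : set R) :
  <<s draw_cylinders i >> E -> measurable D ->
  (P (E `&` theta i @^-1` D) = P E * P (theta i @^-1` D))%E.
Proof.
move=> sE mD.
apply: (indep_g_sigma (@draw_cylinders_measurable i) (@draw_cylindersI i)) sE.
- exists setT, (fun=> setT); split => //; apply/seteqP; split => //.
- by rewrite -[X in measurable X]setTI; exact: measurable_funPT.
- move=> _ [B [A [mB mA Ai ->]]].
  pose A' j := if j == i then D else A j.
  have mA' j : measurable (A' j) by rewrite /A'; case: ifP.
  rewrite (_ : _ `&` _ `&` _ = (Q @^-1` B) `&` [set w | forall j, A' j (theta j w)]).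
    rewrite (hind mB mA') (hind mB mA) -muleA; congr (_ * _)%E.
    rewrite (bigD1 i)//= [in RHS](bigD1 i)//= Ai preimage_setT.
    rewrite [P setT]probability_setT mul1e muleC /A' eqxx; congr (_ * _)%E.
    by apply: eq_bigr => j /negbTE ->.
  apply/seteqP; split => [w [[h1 h2] h3]|w [h1 h2]].
    by split=> // j; rewrite /A'; case: eqP => [->|_]; [exact: h3|exact: h2].
  split; last by have := h2 i; rewrite /A' eqxx.
  split=> // j; have := h2 j; rewrite /A'; case: eqP => // -> _.
  by rewrite Ai.
Qed.

Lemma angle_space_measurable j :
  measurable_fun setT (theta j : angle_space -> R).
Proof.
move=> _ D mD; rewrite setTI; apply: sub_sigma_algebra.
exists (fun k => if k == j then D else setT); split.
  by move=> k; case: ifP => // _; exact: measurableT.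
apply/seteqP; split => [w Dw k|w /(_ j)]; last by rewrite eqxx.
by case: eqP => [->|].
Qed.

Lemma draw_space_measurable_angle i j : j != i ->
  measurable_fun setT (theta j : draw_space i -> R).
Proof.
move=> ji _ D mD; rewrite setTI; apply: sub_sigma_algebra.
exists setT, (fun k => if k == j then D else setT); split => //.
- by move=> k; case: ifP => // _; exact: measurableT.
- by rewrite eq_sym (negbTE ji).
apply/seteqP; split => [w Dw|w [_ /(_ j)]]; last by rewrite eqxx.
by split=> // k; case: eqP => [->|].
Qed.

Lemma draw_space_measurable_frame i :
  measurable_fun setT (Q : draw_space i -> borel_mx R n.+1).
Proof.
move=> _ B mB; rewrite setTI; apply: sub_sigma_algebra.
exists B, (fun=> setT); split => //.
by apply/seteqP; split => [w Bw|w []].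
Qed.

(** The identity of [Omega], valued in a coarser sigma-algebra, is the random variable that packs
    all the angles for [indep_fubini_le]. *)
Lemma measurable_id_angle_space :
  measurable_fun setT (fun w : Omega => w : angle_space).
Proof.
apply: (@measurability _ _ Omega angle_space _ _ angle_cylinders) => //.
by move=> _ [E gE <-]; rewrite setTI; exact: angle_cylinders_measurable.
Qed.

Lemma measurable_id_draw_space i :
  measurable_fun setT (fun w : Omega => w : draw_space i).
Proof.
apply: (@measurability _ _ Omega (draw_space i) _ _ (draw_cylinders i)) => //.
by move=> _ [E gE <-]; rewrite setTI; exact: (@draw_cylinders_measurable i).
Qed.

End draws.

Lemma measurable_lt_cst (disp : measure_display) (T : measurableType disp)
    (R : realType) (f g : T -> R) : measurable_fun setT f -> measurable_fun setT g ->
  measurable [set w | f w < g w].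
Proof.
move=> mf mg; have := measurable_fun_ltr mf mg measurableT (_ : measurable [set true]).
by move=> /(_ _)/wrap[]//; rewrite setTI.
Qed.

(** * The height of a grid direction given the other draws *)

Section bad_events.
Context {disp : measure_display} {Omega : measurableType disp} {R : realType}.
Variables (P : probability Omega R) (n : nat).
Variables (Q : {RV P >-> borel_mx R n.+1}) (theta : 'I_n -> {RV P >-> R}).
Hypothesis hind : independent_draws Q theta.
Hypothesis hQ : haar_frame Q.
Hypothesis htheta : forall i, uniform_angle (theta i).
Variables (le : rel 'rV[R]_n.+1) (x nx : 'rV[R]_n.+1) (T : nat) (h0 : R).
Hypothesis le_complete : total le.
Hypothesis hpfx : plateau_free_at le x.
Hypothesis nx1 : dot nx nx = 1.

Let V (i : 'I_n) (w : Omega) : 'rV[R]_n.+1 :=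
  prefix_dir le x T (Q w : 'M[R]_n.+1) (fun j => theta j w) h0 i.
Let q (i : 'I_n) (w : Omega) : 'rV[R]_n.+1 := row (lift ord0 i) (Q w : 'M[R]_n.+1).

Definition planar_height (i : 'I_n) (c : R) (w : Omega) : R :=
  dot (dir (V i w) (q i w) (theta i w + c)) nx.

Lemma prefix_dir_draw_measurable (i : 'I_n) :
  @vmeasurable _ (g_sigma_algebraType (draw_cylinders Q theta i)) R n.+1 (V i).
Proof.
apply: (@prefix_dir_measurable _ (g_sigma_algebraType (draw_cylinders Q theta i)) R n
  le x le_complete hpfx Q (fun j w => theta j w)).
  exact: draw_space_measurable_frame.
move=> j ji; apply: draw_space_measurable_angle.
by apply/eqP => E; rewrite E ltnn in ji.
Qed.

Lemma planar_height_measurable (i : 'I_n) c : measurable_fun setT (planar_height i c).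
Proof.
have mQ : measurable_fun setT (Q : Omega -> borel_mx R n.+1) by exact: measurable_funPT.
apply: measurable_dot; last exact: vmeasurable_cst.
apply: vmeasurable_dir.
- move=> j; exact: (measurableT_comp (@prefix_dir_draw_measurable i j)
    (@measurable_id_draw_space _ _ _ P n Q theta i)).
- exact: vmeasurable_row.
- by apply: measurable_funD; [exact: measurable_funPT|exact: measurable_cst].
Qed.

(* Conditionally on all draws but [theta i], the height is a sinusoid of
   amplitude at least [`|dot (q i w) nx|] in the uniform angle [theta i]. *)
Lemma planar_height_level (i : 'I_n) (c t s1 s2 : R) : 0 < t -> 0 < s1 -> 0 < s2 ->
  (P [set w | (`|planar_height i c w| < t)%R /\ (s1 <= `|dot (q i w) nx| < s2)%R]
    <= (2 * (t / s1) * (s2 * n.+1%:R))%:E)%E.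
Proof.
move=> t0 s10 s20.
pose TT := g_sigma_algebraType (draw_cylinders Q theta i).
have mQ := @draw_space_measurable_frame _ _ _ P n Q theta i.
have mV := @prefix_dir_draw_measurable i.
have mq : @vmeasurable _ TT R n.+1 (q i) by exact: vmeasurable_row.
have ma : measurable_fun setT (fun w : TT => dot (V i w) nx).
  by apply: measurable_dot => //; exact: vmeasurable_cst.
have mg : measurable_fun setT (fun w : TT => dot (q i w) nx).
  by apply: measurable_dot => //; exact: vmeasurable_cst.
have mng : measurable_fun setT (fun w : TT => `|dot (q i w) nx|).
  exact: (measurableT_comp (@normr_measurable R setT)).
pose E : set TT := [set w | s1 <= `|dot (q i w) nx| < s2].
have mE : measurable E.
  rewrite (_ : E = [set w : TT | `|dot (q i w) nx| < s2] `\`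
                   [set w : TT | `|dot (q i w) nx| < s1]).
    by apply: measurableD; apply: measurable_lt_cst => //; exact: measurable_cst.
  apply/seteqP; split => w; rewrite /E /=.
    by move=> /andP[h1 h2]; split=> //; apply/negP; rewrite -leNgt.
  by move=> [h1 /negP]; rewrite -leNgt => -> /=.
pose B : set (TT * R) := [set z | E z.1 /\
  `|dot (V i z.1) nx * cos (z.2 + c) + dot (q i z.1) nx * sin (z.2 + c)| < t].
have mB : measurable B.
  rewrite (_ : B = (E `*` setT) `&` [set z : TT * R | `|dot (V i z.1) nx * cos (z.2 + c)
      + dot (q i z.1) nx * sin (z.2 + c)| < t]); last first.
    by apply/seteqP; split => z; rewrite /B /=; [move=> [? ?]; do !split|move=> [[? _] ?]; split].
  apply: measurableI; first exact: measurableX.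
  apply: measurable_lt_cst; last exact: measurable_cst.
  apply: (measurableT_comp (@normr_measurable R setT)).
  have mc : measurable_fun setT (fun z : TT * R => z.2 + c).
    by apply: measurable_funD; [exact: measurable_snd|exact: measurable_cst].
  apply: measurable_funD; apply: measurable_funM.
  - exact: (measurableT_comp ma measurable_fst).
  - exact: (measurableT_comp measurable_cos mc).
  - exact: (measurableT_comp mg measurable_fst).
  - exact: (measurableT_comp measurable_sin mc).
have mth : measurable_fun setT (theta i) by exact: measurable_funPT.
have k0 : 0 <= 2 * (t / s1) by rewrite mulr_ge0// divr_ge0// ltW.
have := indep_fubini_le (P := P) (@measurable_id_draw_space _ _ _ P n Q theta i) mth _ mB mE k0.
move=> /(_ _ _ _)/wrap[].
- move=> A D mA mD; exact: (@indep_draws_angle _ _ _ P n Q theta hind i A D mA mD).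
- move=> w Ew; have /andP[h1 _] := Ew.
  have := uniform_sinusoid_le (dot (V i w) nx) c (htheta i) t0 s10 h1.
  apply: le_trans; rewrite le_eqVlt; apply/orP; left; apply/eqP; congr (P _).
  apply/seteqP; split => w'; rewrite /xsection /B /= inE /=; first by case.
  by move=> ?; split.
- move=> w Ew; rewrite (_ : _ @^-1` _ = set0) ?measure0//.
  by apply/seteqP; split => w' //; rewrite /xsection /B /= inE /= => -[].
move=> bound; rewrite EFinM.
apply: (@le_trans _ _ ((2 * (t / s1))%:E * P E)%E).
  apply: le_trans bound; rewrite le_eqVlt; apply/orP; left; apply/eqP; congr (P _).
  have E1 w : planar_height i c w = dot (V i w) nx * cos (theta i w + c)
      + dot (q i w) nx * sin (theta i w + c).
    by rewrite /planar_height dot_dir; congr (_ + _); exact: mulrC.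
  apply/seteqP; split => w; rewrite /B /= => -[h1 h2].
    by split; [|rewrite -E1].
  by split; [rewrite E1|].
(* The lower end [s1] has served to bound the amplitude; the upper end [s2] now bounds the
   probability of the level. *)
rewrite lee_wpmul2l ?lee_fin//.
apply: le_trans (haar_anticoncentration hQ (lift ord0 i) s20 nx1).
apply: le_measure; rewrite ?inE.
- have := @measurable_id_draw_space _ _ _ P n Q theta i measurableT _ mE.
  by rewrite setTI.
- exact: measurable_row_dot_lt.
- by move=> w /andP[].
Qed.
End bad_events.

(** * Numeric bounds *)

Section numeric_bounds.
Variable R : realType.
Implicit Types y : R.

Lemma threshold_gt0 (eps delta D : R) : 0 < eps -> 0 < delta -> 0 < D ->
  0 < eps * delta ^+ 2 / (256 * D ^+ 3).
Proof.
move=> e0 d0 D0; apply: divr_gt0; apply: mulr_gt0 => //; first exact: exprn_gt0.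
exact: exprn_gt0.
Qed.

Lemma log2_le_nat y (k : nat) : 0 < y -> (log2 y <= k%:R) = (y <= 2 ^+ k).
Proof.
move=> y0; have l2 : 0 < ln (2 : R) by rewrite ln_gt0// ltr1n.
rewrite /log2 ler_pdivrMr// mulr_natl -lnXn// ler_ln// posrE exprn_gt0//.
Qed.

Lemma log2_gt_nat y (k : nat) : 0 < y -> (k%:R < log2 y) = (2 ^+ k < y).
Proof. by move=> y0; rewrite !ltNge log2_le_nat. Qed.

Lemma steps_bounds (n : nat) (eps : R) : (0 < n)%N -> 0 < eps -> eps <= Num.sqrt 2 ->
  [/\ (0 < steps n eps)%N, 2 ^+ steps n eps < pi * Num.sqrt n%:R / eps
    & pi * Num.sqrt n%:R / (2 * eps) <= 2 ^+ steps n eps].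
Proof.
move=> n0 e0 e2; have pi0 := pi_gt0 R.
have sn : 1 <= Num.sqrt n%:R :> R.
  by rewrite -[leLHS]sqrtr1 ler_sqrt ?ler1n// ler0n.
have s2 : Num.sqrt 2 < 3 / 2 :> R.
  rewrite -[ltRHS]ger0_norm// -sqrtr_sqr ltr_sqrt; last by rewrite exprn_gt0.
  by rewrite expr2; lra.
set X := pi * Num.sqrt n%:R / (2 * eps).
(* For [n = 1] and [eps = sqrt 2], a positive number of steps needs [2 * sqrt 2 < pi], beyond the
   reach of [pi_ge2]. If [pi <= 3], the quadratic bound gives [cos (pi / 4) >= 71 / 100] and
   duplication then makes [cos (pi / 2)] positive. *)
have piB : 3 < pi :> R.
  rewrite ltNge; apply/negP => pi3.
  have c0 := cos_pihalf R; have := pi_ge2 R => pi2.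
  have := cos_ge_quadratic (_ : 0 <= pi / 4) (_ : pi / 4 <= pi :> R).
  rewrite divr_ge0 ?(ltW pi0)// ler_pdivrMr// ler_peMr ?(ltW pi0) ?ler1n// => /(_ isT isT).
  move=> c4; have : cos (pi / 2) = cos (pi / 4) ^+ 2 *+ 2 - 1 :> R.
    by rewrite -cos_mulr2n -[_ *+ 2]mulr_natr; congr cos; field.
  rewrite c0; move: c4; set C := cos (pi / 4); move: pi2 pi3; clear; move: C pi => C p p2 p3 C4.
  have C7 : 71 / 100 <= C by nra.
  have : (71 / 100) ^+ 2 <= C ^+ 2 by nra.
  lra.
have X1 : 1 < X.
  rewrite /X ltr_pdivlMr ?mulr_gt0// mul1r.
  have : pi * 1 <= pi * Num.sqrt n%:R :> R by rewrite ler_pM2l.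
  by move: piB s2 e2; clear; move: pi (Num.sqrt n%:R) (Num.sqrt 2) => p sn r2; lra.
have X0 : 0 < X by apply: lt_trans X1.
have c0 : 0 < Num.ceil (log2 X).
  by rewrite ceil_gt0 (log2_gt_nat 0 X0) expr0.
have TE : (steps n eps)%:Z = Num.ceil (log2 X) by rewrite /steps gez0_abs// ltW.
split.
- by rewrite -ltz_nat TE.
- have : (steps n eps)%:Z - 1 < Num.ceil (log2 X) by rewrite TE; lia.
  rewrite ceil_gt_int.
  have [k kE] : exists k, steps n eps = k.+1.
    by exists (steps n eps).-1; rewrite prednK// -ltz_nat TE.
  rewrite kE (_ : k.+1%:Z - 1 = k%:Z); last by lia.
  rewrite -pmulrn log2_gt_nat// /X exprS => h.
  rewrite -(@ltr_pM2l _ 2^-1) ?invr_gt0// mulKf//.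
  by apply: lt_le_trans h _; rewrite invfM; clear; move: pi => p; lra.
have : Num.ceil (log2 X) <= (steps n eps)%:Z by rewrite TE.
by rewrite ceil_le_int -pmulrn log2_le_nat.
Qed.

(** With [pi <= 7 / 2], the upper bound on [2 ^+ T] becomes [2 ^+ T.+1 < 7 * sqrt n / eps], and
    strictness pushes the ceiling past [T + 1]. The constant 7 thus absorbs the two initial searches
    of each plane. *)
Lemma comparisons_per_plane (n : nat) (eps : R) :
  (0 < n)%N -> 0 < eps -> eps <= Num.sqrt 2 ->
  (steps n eps)%:Z + 2 <= Num.ceil (log2 (7 * Num.sqrt n%:R / eps)).
Proof.
move=> n0 e0 e2; have [_ T2 _] := steps_bounds n0 e0 e2.
have sn : 0 < Num.sqrt n%:R :> R by rewrite sqrtr_gt0 ltr0n.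
have -> : (steps n eps)%:Z + 2 = (steps n eps).+1%:Z + 1 by lia.
rewrite lezD1 ceil_gt_int -pmulrn log2_gt_nat; last by rewrite divr_gt0// mulr_gt0.
rewrite exprS.
have : pi * Num.sqrt n%:R / eps <= 7 / 2 * (Num.sqrt n%:R / eps).
  by rewrite -mulrA ler_wpM2r ?pi_le_7half// divr_ge0 ?sqrtr_ge0// ltW.
rewrite -!mulrA; move: T2; rewrite -!mulrA => /lt_le_trans/[apply]; clear.
by move: (2 ^+ _) (_ / eps) => a b; lra.
Qed.

(** The number of steps is such that [b * sqrt n <= eps]; the quadratic bound on the cosine and
    Bernoulli's inequality then suffice. *)
Lemma cos_pow_ge (n : nat) (eps : R) : (0 < n)%N -> 0 < eps -> eps <= Num.sqrt 2 ->
  1 - eps ^+ 2 / 2 <= cos (pi / 2 ^+ (steps n eps).+1) ^+ n.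
Proof.
move=> n0 e0 e2; have [T0 _ T2] := steps_bounds n0 e0 e2.
set b := pi / _; have pi0 := pi_gt0 R.
have sn : 0 < Num.sqrt n%:R :> R by rewrite sqrtr_gt0 ltr0n.
have b0 : 0 < b by rewrite divr_gt0// exprn_gt0.
have b1 : b <= 1.
  rewrite /b ler_pdivrMr ?exprn_gt0// mul1r.
  apply: (@le_trans _ _ (2 ^+ 2)); first by apply: le_trans (pi_le_7half R) _; rewrite expr2; clear; lra.
  by rewrite ler_weXn2l ?ler1n.
have be : b * Num.sqrt n%:R <= eps.
  rewrite /b mulrAC ler_pdivrMr ?exprn_gt0// exprS.
  move: T2; rewrite ler_pdivrMr ?mulr_gt0//; clear.
  by move: (pi * _) (2 ^+ _) => a c; lra.
have be2 : b ^+ 2 * n%:R <= eps ^+ 2.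
  rewrite -[X in _ * X](@sqr_sqrtr _ n%:R)// -exprMn ler_sqr ?nnegrE ?(ltW e0)//.
  by rewrite mulr_ge0// ltW.
clearbody b; clear T2.
have bern k : 1 - k%:R * (b ^+ 2 / 2) <= (1 - b ^+ 2 / 2) ^+ k.
  elim: k => [|k IH]; first by rewrite mul0r subr0 expr0.
  rewrite -(natr1 k).
  have h : 0 <= b ^+ 2 / 2 <= 1 by have := sqr_ge0 b; nra.
  have b1' : 0 <= 1 - b ^+ 2 / 2 by lra.
  have h2 := ler_wpM2r b1' IH; rewrite -exprSr in h2; apply: le_trans _ h2; have : 0 <= k%:R :> R by [].
  by move: h; set u := b ^+ 2 / 2; nra.
apply: (@le_trans _ _ (1 - n%:R * (b ^+ 2 / 2))); first lra.
apply: le_trans (bern n) _; apply: lerXn2r; rewrite ?nnegrE.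
- by nra.
- apply: cos_ge0_pihalf; rewrite (le_trans b1 (pihalf_ge1 R)) andbT.
  by apply: le_trans (ltW b0); rewrite oppr_le0 divr_ge0// ltW.
- apply: cos_ge_quadratic; first exact: ltW.
  by apply: (le_trans b1); apply: le_trans (pi_ge2 R); rewrite ler1n.
Qed.

(** The ratio peaks at [J = 6], where it is [1296 / 64 = 20.25]; from there on,
    [(J + 1)^4 <= 2 J^4]. *)
Lemma pow4_le_pow2 (J : nat) : (J ^ 4 <= 21 * 2 ^ J)%N.
Proof.
do 6 (case: J => [//|J]).
elim: J => [//|J IH]; rewrite expnS.
have double (a b : nat) : (a <= 21 * b -> 2 * a <= 21 * (2 * b))%N by lia.
apply: leq_trans (double _ _ IH).
by rewrite !expnS !expn0; nia.
Qed.

(* The number of dyadic levels of [`|dot q nx|] between [delta / (2 n d)]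
   and 1 grows only logarithmically in [n / delta]. *)
Lemma levels_bound (n T : nat) (eps delta t s : R) : (0 < n)%N -> 0 < eps ->
  0 < delta < 1 -> t = eps * delta ^+ 2 / (256 * n.+1%:R ^+ 3) ->
  s = delta / (2 * n%:R * n.+1%:R) -> 2 ^+ T < pi * Num.sqrt n%:R / eps ->
  exists J : nat, 1 < 2 ^+ J * s /\
    n%:R * (s * n.+1%:R + (2 ^ T.+1)%:R * J%:R * (4 * t * n.+1%:R)) <= delta.
Proof.
move=> n0 e0 /andP[d0 d1] tE sE T2.
have nR : 1 <= n%:R :> R by rewrite ler1n.
have dR : n.+1%:R = n%:R + 1 :> R by rewrite natr1.
set N := n%:R in nR dR sE T2 *; set D := n.+1%:R in dR tE sE *.
have D0 : 0 < D by rewrite dR; lra.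
have N0 : 0 < N by lra.
pose y := 2 * N * D / delta.
have y0 : 0 < y by rewrite divr_gt0// !mulr_gt0.
have ys : y * s = 1 by rewrite /y sE; field; rewrite !gt_eqF.
have y1 : 1 < y.
  by rewrite /y ltr_pdivlMr// mul1r (lt_trans d1)//; nra.
have ex : exists J : nat, y < 2 ^+ J.
  exists (Num.bound y); apply: lt_le_trans (archi_boundP (ltW y0)) _.
  by rewrite -natrX ler_nat ltnW// ltn_expl.
case: (ex_minnP ex) => -[|J]; first by rewrite expr0 => /(lt_trans y1); rewrite ltxx.
move=> yJ Jmin.
have yJ' : 2 ^+ J <= y.
  by rewrite leNgt; apply/negP => /Jmin; rewrite ltnn.
have yE : 84 * (N * D) / delta = 42 * y by rewrite /y; field; rewrite gt_eqF.
clearbody y.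
exists J.+1; split.
  by rewrite -[ltLHS]ys ltr_pM2r// sE; apply: divr_gt0 => //; do 2 apply: mulr_gt0 => //.
set j := J.+1%:R : R; have j0 : 0 <= j by rewrite ler0n.
have j4 : j ^+ 4 <= 84 * (N * D) / delta.
  have : j ^+ 4 <= 21 * (2 * 2 ^+ J).
    by rewrite -exprS /j -!natrX -natrM ler_nat pow4_le_pow2.
  by move=> /le_trans; apply; rewrite yE; move: yJ'; clear; move: (2 ^+ J) => p; lra.
(* This is what remains after substituting [t] and the bound on [2 ^+ T]. The fourth power clears
   the root and uses [j4]: the powers of the dimension match as [N^(3/2) (N D)^(1/4) <= D^2], and
   the constants as [7^4 * 84 <= 32^4]. *)
have nj : 7 * (N * Num.sqrt N) * (j * delta) <= 32 * D ^+ 2.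
  have r0 : 0 <= Num.sqrt N by rewrite sqrtr_ge0.
  rewrite -(@ler_pXn2r _ 4) ?nnegrE ?mulr_ge0// ?(ltW N0) ?(ltW d0) ?exprn_ge0// ?(ltW D0)//.
  have r4 : Num.sqrt N ^+ 4 = N ^+ 2.
    by rewrite (exprM _ 2 2) sqr_sqrtr// ltW.
  rewrite !exprMn r4.
  have h1 : j ^+ 4 * delta ^+ 4 <= 84 * (N * D).
    apply: (@le_trans _ _ (84 * (N * D) / delta * delta ^+ 4)).
      by rewrite ler_pM2r// exprn_gt0.
    rewrite (exprS _ 3) mulrA divfK ?gt_eqF// ler_piMr ?mulr_ge0 ?ltW//.
    by rewrite exprn_ilt1// ltW.
  have h2 : N ^+ 6 * (N * D) <= D ^+ 8.
    rewrite mulrA -exprSr (exprSr _ 7) ler_pM2r//.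
    by apply: lerXn2r; rewrite ?nnegrE ?(ltW N0) ?(ltW D0)// dR; lra.
  have h3 := ler_wpM2l (_ : 0 <= 7 ^+ 4 * N ^+ 6) h1.
  rewrite (_ : 7 ^+ 4 * (N ^+ 4 * N ^+ 2) * (j ^+ 4 * delta ^+ 4) =
    7 ^+ 4 * N ^+ 6 * (j ^+ 4 * delta ^+ 4)); last by ring.
  apply: le_trans (h3 _) _; first by rewrite mulr_ge0// exprn_ge0// ltW.
  rewrite (_ : 7 ^+ 4 * N ^+ 6 * (84 * (N * D)) = 7 ^+ 4 * 84 * (N ^+ 6 * (N * D))); last by ring.
  apply: (@le_trans _ _ (7 ^+ 4 * 84 * D ^+ 8)); first by rewrite ler_pM2l.
  rewrite (_ : 32 ^+ 4 * _ = 32 ^+ 4 * D ^+ 8); last by ring.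
  rewrite ler_pM2r ?exprn_gt0//; rewrite !exprS expr0; clear; lra.
rewrite natrX exprS mulrDr.
(* Slopes below [s] use half of [delta], which leaves the other half to the dyadic levels. *)
have -> : N * (s * D) = delta / 2 by rewrite sE; field; rewrite !gt_eqF.
have t0 : 0 < t by rewrite tE; exact: threshold_gt0.
have piT : 2 ^+ T <= 7 / 2 * Num.sqrt N / eps.
  apply: le_trans (ltW T2) _; rewrite ler_pM2r ?invr_gt0//.
  by rewrite ler_wpM2r ?sqrtr_ge0 ?pi_le_7half.
suff : N * (2 * 2 ^+ T * j * (4 * t * D)) <= delta / 2 by lra.
apply: (@le_trans _ _ (N * (2 * (7 / 2 * Num.sqrt N / eps) * j * (4 * t * D)))).
  rewrite ler_pM2l// ler_pM2r ?mulr_gt0// ler_wpM2r// ler_pM2l//.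
rewrite (_ : N * _ = 7 * (N * Num.sqrt N) * (j * delta) * (delta / (64 * D ^+ 2))); last first.
  by rewrite tE; field; rewrite !gt_eqF.
apply: (@le_trans _ _ (32 * D ^+ 2 * (delta / (64 * D ^+ 2)))).
  by rewrite ler_wpM2r// divr_ge0 ?(ltW d0)// mulr_ge0// exprn_ge0// ltW.
by rewrite le_eqVlt; apply/orP; left; apply/eqP; field; rewrite gt_eqF.
Qed.

(** For finite [r], [r * t < h0 / 2 ^+ k] means [2 ^+ k < 2 ^+ 8 * (h0 d^3 / (r eps)) * delta^-2];
    the strict inequality of exponents leaves 7 of the 8, and the square doubles the logarithm of
    [1 / delta]. *)
Lemma halvings_bound (d : nat) (rx : \bar R) (h0 eps delta : R) (k : nat) :
  (0 < d)%N -> (0 < rx)%E -> 0 < h0 -> 0 < eps -> 0 < delta < 1 ->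
  halved rx (eps * delta ^+ 2 / (256 * d%:R ^+ 3)) h0 k ->
  k%:Z <= radius_term d h0 rx eps + 7 + 2 * Num.ceil (log2 (1 / delta)).
Proof.
move=> d_gt0 rx0 hh0 e0 /andP[d0 d1].
have D0 : 0 < d%:R :> R by rewrite ltr0n.
set t := eps * _ / _; have t0 : 0 < t by exact: threshold_gt0.
have dV : 1 < 1 / delta by rewrite ltr_pdivlMr// mul1r.
have [c cE] : exists c : nat, Num.ceil (log2 (1 / delta)) = c%:Z.
  exists `|Num.ceil (log2 (1 / delta))|%N; rewrite gez0_abs// ltW// ceil_gt0.
  by rewrite (log2_gt_nat 0) ?expr0// (lt_trans _ dV).
have c2 : 1 / delta <= 2 ^+ c.
  by rewrite -log2_le_nat ?(lt_trans _ dV)// pmulrn -ceil_le_int cE.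
have [a aE] : exists a : nat, radius_term d h0 rx eps = a%:Z.
  exists `|radius_term d h0 rx eps|%N; rewrite gez0_abs//.
  by rewrite /radius_term; case: (rx) => // r; rewrite /ceil_plus le_max lexx orbT.
rewrite cE aE => -[->|hk]; first lia.
(* For an infinite radius, [r = h0 / t] would give [h0 < h0 / 2 ^+ k], which is impossible. *)
case: rx rx0 hk aE => [r r0|_|//] hk; last first.
  have := hk (h0 / t) (divr_gt0 hh0 t0) (leey _); rewrite divfK ?gt_eqF//.
  by rewrite ltr_pdivlMr ?exprn_gt0// ltNge ler_peMr ?(ltW hh0) ?exprn_ege1 ?ler1n.
rewrite /radius_term /ceil_plus => aE.
rewrite lte_fin in r0.
have := hk r r0 (lexx _); rewrite ltr_pdivlMr ?exprn_gt0// => hkr.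
have L2 : h0 * d%:R ^+ 3 / (r * eps) <= 2 ^+ a.
  rewrite -log2_le_nat; last by rewrite divr_gt0 ?mulr_gt0 ?exprn_gt0.
  by rewrite [a%:R]pmulrn -ceil_le_int -aE le_max lexx.
have key : 2 ^+ k < 2 ^+ (8 + a + 2 * c) :> R.
  rewrite (_ : 2 ^+ (8 + a + 2 * c) = 2 ^+ 8 * 2 ^+ a * (2 ^+ c) ^+ 2 :> R); last first.
    by rewrite (exprD _ (8 + a)) (exprD _ 8) (mulnC 2%N) exprM.
  have L0 : 0 < h0 * d%:R ^+ 3 / (r * eps) by rewrite divr_gt0 ?mulr_gt0 ?exprn_gt0.
  apply: (@lt_le_trans _ _ (2 ^+ 8 * (h0 * d%:R ^+ 3 / (r * eps)) * (1 / delta) ^+ 2)).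
    have rt0 : 0 < r * t by exact: mulr_gt0.
    rewrite -(ltr_pM2l rt0); apply: (lt_le_trans hkr).
    rewrite le_eqVlt; apply/orP; left; apply/eqP.
    rewrite /t !exprS expr0; field; rewrite !gt_eqF//.
  have dV0 : 0 <= 1 / delta by rewrite divr_ge0// ltW.
  apply: ler_pM.
  - by rewrite mulr_ge0 ?exprn_ge0// ltW.
  - exact: exprn_ge0.
  - by rewrite ler_pM2l// exprn_gt0.
  - by apply: lerXn2r => //; rewrite nnegrE exprn_ge0.
by move: key; rewrite ltr_eXn2l ?ltr1n//; clear; lia.
Qed.

End numeric_bounds.

(** * The good event *)

Lemma in_bigsetU_ord (T : Type) (K : nat) (F : nat -> set T) (w : T) :
  (\big[setU/set0]_(m < K) F m) w <-> exists2 m, (m < K)%N & F m w.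
Proof. by rewrite -bigcup_mkord; split => -[m mK Fm]; exists m. Qed.

Lemma measure_bigsetU_seq_le (disp : measure_display) (T : measurableType disp)
    (R : realType) (mu : probability T R) (I : Type) (s : seq I) (F : I -> set T) :
  (forall i, measurable (F i)) ->
  (mu (\big[setU/set0]_(i <- s) F i) <= \sum_(i <- s) mu (F i))%E.
Proof.
move=> mF; elim: s => [|i s IH]; first by rewrite !big_nil measure0.
rewrite !big_cons; apply: le_trans (measureU2 _ _ _) _ => //.
  by apply: bigsetU_measurable => j _.
by rewrite leeD2l.
Qed.

Section good_event.
Context {disp : measure_display} {Omega : measurableType disp} {R : realType}.
Variables (P : probability Omega R) (n : nat).
Variables (Q : {RV P >-> borel_mx R n.+1}) (theta : 'I_n -> {RV P >-> R}).
Hypothesis hind : independent_draws Q theta.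
Hypothesis hQ : haar_frame Q.
Hypothesis htheta : forall i, uniform_angle (theta i).
Variables (le : rel 'rV[R]_n.+1) (x nx : 'rV[R]_n.+1) (T : nat) (h0 : R).
Hypothesis le_complete : total le.
Hypothesis hpfx : plateau_free_at le x.
Hypothesis nx1 : dot nx nx = 1.
Local Notation height := (planar_height Q theta le x nx T h0).
Local Notation slope i w := (dot (row (lift ord0 i) (Q w : 'M[R]_n.+1)) nx).

Let mheight i c (t : R) : measurable [set w | `|height i c w| < t].
Proof.
apply: measurable_lt_cst; last exact: measurable_cst.
apply: (measurableT_comp (@normr_measurable R setT)).
exact: planar_height_measurable.
Qed.

(** Consecutive levels have ratio 2, so the amplitude and the probability of the level compensate:
    each of the [J] levels contributes [4 * t * d] whatever its height. Slopes below [s] are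
    discarded at cost [s * d], and [2 ^+ J * s > 1] ensures that no slope lies above the levels. *)
Lemma planar_bad_le (i : 'I_n) (c : nat -> R) (K J : nat) (t s : R) :
  0 < t -> 0 < s -> 1 < 2 ^+ J * s ->
  (P (\big[setU/set0]_(m < K) [set w | (`|height i (c m) w| < t)%R]) <=
   (s * n.+1%:R + K%:R * J%:R * (4 * t * n.+1%:R))%:E)%E.
Proof.
move=> t0 s0 hJ.
pose small := [set w | `|slope i w| < s].
pose level (m l : nat) := [set w | `|height i (c m) w| < t /\
  2 ^+ l * s <= `|slope i w| < 2 ^+ l.+1 * s].
have msmall : measurable small by exact: measurable_row_dot_lt.
have mlevel m l : measurable (level m l).
  rewrite (_ : level m l = [set w | `|height i (c m) w| < t] `&`
    ([set w | `|slope i w| < 2 ^+ l.+1 * s] `\` [set w | `|slope i w| < 2 ^+ l * s])).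
    apply: measurableI => //; apply: measurableD; exact: measurable_row_dot_lt.
  apply/seteqP; split => w; rewrite /level /=.
    by move=> [h1 /andP[h2 h3]]; do 2 split => //; apply/negP; rewrite -leNgt.
  by move=> [h1 [h2 /negP]]; rewrite -leNgt => h3; split => //; rewrite h3.
have p0 l : 0 < 2 ^+ l * s by rewrite mulr_gt0// exprn_gt0.
have plevel m l : (P (level m l) <= (4 * t * n.+1%:R)%:E)%E.
  have := planar_height_level hind hQ htheta T h0 le_complete hpfx nx1 i (c m) t0 (p0 l) (p0 l.+1).
  move=> /le_trans; apply; rewrite lee_fin le_eqVlt; apply/orP; left; apply/eqP.
  by rewrite exprS; field; rewrite !gt_eqF// exprn_gt0.
apply: (@le_trans _ _ (P (small `|` \big[setU/set0]_(m < K)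
    \big[setU/set0]_(l < J) level m l))).
  apply: le_measure; rewrite ?inE.
  - by apply: bigsetU_measurable => m _; exact: mheight.
  - apply: measurableU => //; apply: bigsetU_measurable => m _.
    by apply: bigsetU_measurable => l _.
  move=> w /(in_bigsetU_ord K (fun m => [set w | `|height i (c m) w| < t]))[m mK hm].
  have [ws|ws] := ltP `|slope i w| s; [by left|right].
  apply/(in_bigsetU_ord K (fun m => \big[setU/set0]_(l < J) level m l)).
  exists m => //; apply/(in_bigsetU_ord J (level m)).
  have ex : exists l : nat, `|slope i w| < 2 ^+ l.+1 * s.
    exists J; apply: (@le_lt_trans _ _ 1).
      exact: (dot_row_le1 _ (hQ.1 w) nx1).
    apply: (lt_le_trans hJ); rewrite ler_wpM2r ?(ltW s0)//.
    by rewrite ler_weXn2l ?ler1n.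
  case: (ex_minnP ex) => l hl lmin.
  have lo : 2 ^+ l * s <= `|slope i w|.
    case: l hl lmin => [|l] hl lmin; first by rewrite expr0 mul1r.
    by rewrite leNgt; apply/negP => /lmin; rewrite ltnn.
  exists l; last by split => //; rewrite lo.
  rewrite /= ltnNge; apply/negP => Jl.
  have : `|slope i w| < 2 ^+ l * s.
    apply: (@le_lt_trans _ _ 1); first exact: (dot_row_le1 _ (hQ.1 w) nx1).
    apply: (lt_le_trans hJ); rewrite ler_wpM2r ?(ltW s0)//.
    by rewrite ler_weXn2l ?ler1n.
  by rewrite ltNge lo.
apply: le_trans (measureU2 _ _ _) _ => //.
  by apply: bigsetU_measurable => m _; apply: bigsetU_measurable => l _.
rewrite EFinD; apply: leeD; first exact: haar_anticoncentration.
apply: le_trans (@le_mu_bigsetU _ _ _ P (fun m => \big[setU/set0]_(l < J) level m l) K _) _.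
  by move=> m _; apply: bigsetU_measurable => l _.
apply: (@le_trans _ _ (\sum_(m < K) (J%:R * (4 * t * n.+1%:R))%:E)%E).
  apply: lee_sum => m _.
  apply: le_trans (@le_mu_bigsetU _ _ _ P (level m) J _) _ => //.
  apply: (@le_trans _ _ (\sum_(l < J) (4 * t * n.+1%:R)%:E)%E).
    by apply: lee_sum => l _; exact: plevel.
  by rewrite sumEFin lee_fin sumr_const card_ord -[leLHS]mulr_natl.
by rewrite sumEFin lee_fin sumr_const card_ord -[leLHS]mulr_natl (mulrA K%:R).
Qed.

(** A half turn is [2 ^ T.+1] grid steps and only flips the sign, so finitely many angles control
    them all. *)
Lemma planar_height_mod (i : 'I_n) (t : R) w :
  (forall m, (m < 2 ^ T.+1)%N -> t <= `|height i (m%:R * (pi / 2 ^+ T.+1)) w|) ->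
  forall m, t <= `|height i (m%:R * (pi / 2 ^+ T.+1)) w|.
Proof.
move=> H m; elim/ltn_ind: m => m IH.
have [mT|mT] := ltnP m (2 ^ T.+1); first exact: H.
have mE : m = (m - 2 ^ T.+1 + 2 ^ T.+1)%N by rewrite subnK.
rewrite mE natrD mulrDl natrX.
have -> : 2 ^+ T.+1 * (pi / 2 ^+ T.+1) = pi :> R.
  by rewrite mulrCA divff ?mulr1// expf_neq0.
rewrite /planar_height addrA dirDpi dotNl normrN; apply: IH.
by rewrite ltn_subrL expn_gt0/= (leq_trans _ mT)// expn_gt0.
Qed.

Lemma good_event (eps delta : R) : (0 < n)%N -> 0 < eps -> 0 < delta < 1 ->
  2 ^+ T < pi * Num.sqrt n%:R / eps ->
  exists2 A : set Omega, measurable A & ((1 - delta)%:E <= P A)%E /\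
    forall w, A w -> forall i (m : nat),
      eps * delta ^+ 2 / (256 * n.+1%:R ^+ 3) <=
        `|height i (m%:R * (pi / 2 ^+ T.+1)) w|.
Proof.
move=> n0 e0 d01 T2; set t := eps * _ / _.
have /andP[d0 d1] := d01.
(* Each plane may fail with probability [delta / n]; small slopes take half of it, as
   [s * d = delta / (2 n)]. *)
pose s := delta / (2 * n%:R * n.+1%:R).
have [J [hJ bound]] := levels_bound n0 e0 d01 (erefl t) (erefl s) T2.
have t0 : 0 < t by apply: threshold_gt0 => //; rewrite ltr0n.
have s0 : 0 < s by rewrite divr_gt0 ?mulr_gt0 ?ltr0n.
pose c (m : nat) : R := m%:R * (pi / 2 ^+ T.+1).
pose bad i := \big[setU/set0]_(m < 2 ^ T.+1) [set w | `|height i (c m) w| < t].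
have mbad i : measurable (bad i) by apply: bigsetU_measurable => m _; exact: mheight.
pose allbad := \big[setU/set0]_(i < n) bad i.
have mall : measurable allbad by apply: bigsetU_measurable => i _.
exists (~` allbad); first exact: measurableC.
split; last first.
  move=> w gw i; apply: planar_height_mod => m mT.
  rewrite leNgt; apply/negP => hm; apply: gw.
  rewrite /allbad -bigcup_seq; exists i; rewrite /= ?mem_index_enum//.
  by apply/(in_bigsetU_ord _ (fun m => [set w | `|height i (c m) w| < t])); exists m.
rewrite probability_setC// EFinB; apply: leeB => //.
apply: (@le_trans _ _ (\sum_(i < n) P (bad i))%E).
  exact: measure_bigsetU_seq_le.
apply: (@le_trans _ _ (\sum_(i < n)
   (s * n.+1%:R + (2 ^ T.+1)%:R * J%:R * (4 * t * n.+1%:R))%:E)%E).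
  by apply: lee_sum => i _; exact: planar_bad_le.
by rewrite sumEFin lee_fin sumr_const card_ord -[leLHS]mulr_natl.
Qed.

(** Lists and radii are countably many, so a single pair suffices. In [indep_fubini_le] the constant
    [k = 0] turns null sections into a null event, and lists that give no unit vector have empty
    sections. *)
Lemma no_tie_ae : ties_negligible le x h0 Q ->
  {ae P, forall w, no_tie le x T (Q w : 'M[R]_n.+1) (fun i => theta i w) h0}.
Proof.
move=> ties.
pose N (lk : seq ('I_n * nat) * nat) := [set w |
  dot (frame_coords (fun i => theta i w) (pi / 2 ^+ T.+1) lk.1)
      (frame_coords (fun i => theta i w) (pi / 2 ^+ T.+1) lk.1) = 1 /\
  indiff le (x + (h0 / 2 ^+ lk.2) *:
    (frame_coords (fun i => theta i w) (pi / 2 ^+ T.+1) lk.1 *m (Q w : 'M[R]_n.+1))) x].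
suff N0 lk : P.-negligible (N lk).
  apply: (@negligibleS _ _ _ _ (\bigcup_k if unpickle k is Some lk then N lk else set0)).
    move=> w /= hw; apply: contrapT => nN; apply: hw => l k l1; apply/negP => tie.
    by apply: nN; exists (pickle (l, k)) => //; rewrite pickleK.
  apply: negligible_bigcup => k; case: unpickle => [lk|]; first exact: N0.
  exact: negligible_set0.
case: lk => l k.
pose TT := g_sigma_algebraType (angle_cylinders theta).
pose al (w : TT) := frame_coords (fun i => theta i w) (pi / 2 ^+ T.+1) l.
have mal : vmeasurable al.
  apply: (@frame_coords_measurable _ TT R n (fun i w => theta i w)) => i.
  exact: angle_space_measurable.
have mQ : measurable_fun setT (Q : Omega -> borel_mx R n.+1) by exact: measurable_funPT.
have mtie (d' : measure_display) (S : measurableType d') (y : S -> 'rV[R]_n.+1) :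
    vmeasurable y -> measurable [set z | indiff le (x + (h0 / 2 ^+ k) *: y z) x].
  move=> my; rewrite -[X in measurable X]setTI.
  have mxy : vmeasurable (fun z => x + (h0 / 2 ^+ k) *: y z).
    by apply: vmeasurable_add_scale => //; exact: measurable_cst.
  have mb : measurable_fun setT (fun z => indiff le (x + (h0 / 2 ^+ k) *: y z) x).
    by apply: measurable_and; [exact: measurable_le_left|exact: measurable_le_right].
  exact: (mb measurableT [set true]).
pose B : set (TT * borel_mx R n.+1) := [set z | dot (al z.1) (al z.1) = 1 /\
  indiff le (x + (h0 / 2 ^+ k) *: (al z.1 *m (z.2 : 'M[R]_n.+1))) x].
have mB : measurable B.
  rewrite (_ : B = ([set w | dot (al w) (al w) = 1] `*` setT) `&`
    [set z : TT * borel_mx R n.+1 |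
      indiff le (x + (h0 / 2 ^+ k) *: (al z.1 *m (z.2 : 'M[R]_n.+1))) x]); last first.
    by apply/seteqP; split => z; [move=> [? ?]; do !split|move=> [[? _] ?]; split].
  apply: measurableI.
    apply: measurableX => //.
    have := measurable_dot mal mal measurableT (measurable_set1 (1 : R)).
    by rewrite setTI.
  apply: mtie; apply: vmeasurable_mulmx; first exact: measurable_snd.
  move=> j; exact: (measurableT_comp (mal j) measurable_fst).
have row0 : P [set w | indiff le (x + (h0 / 2 ^+ k) *: row ord0 (Q w : 'M[R]_n.+1)) x] = 0%E.
  apply/negligibleP.
    by apply: mtie; exact: vmeasurable_row.
  by apply: negligibleS ties => w /= tie H; have := H k; rewrite tie.
have mU : measurable ([set M | indiff le (x + (h0 / 2 ^+ k) *: row ord0 M) x]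
    : set (borel_mx R n.+1)).
  apply: (mtie _ (borel_mx R n.+1) (fun M => row ord0 (M : 'M[R]_n.+1))) => j.
  under eq_fun do rewrite mxE.
  have mI : measurable_fun setT (fun M : borel_mx R n.+1 => M) by exact: measurable_id.
  exact: measurable_borel_entry mI.
have PN : (P (N (l, k)) <= 0%:E * P ((fun w : Omega => w : TT) @^-1` setT))%E.
  apply: (indep_fubini_le (P := P) (@measurable_id_angle_space _ _ _ P n theta) mQ _
    mB measurableT (lexx 0)) => //.
  - by move=> A D mA mD; exact: (indep_angles_frame hind).
  - move=> w _; have [al1|al1] := eqVneq (dot (al w) (al w)) 1; last first.
      rewrite (_ : _ @^-1` _ = set0) ?measure0//.
      apply/seteqP; split => w' //; rewrite /xsection /B /= inE /= => -[al1' _].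
      by rewrite al1' eqxx in al1.
    suff -> : P ((Q : Omega -> borel_mx R n.+1) @^-1` xsection B w) = 0%E by [].
    rewrite -row0; transitivity (P [set w' |
      indiff le (x + (h0 / 2 ^+ k) *: (al w *m (Q w' : 'M[R]_n.+1))) x]); last first.
      exact: (haar_row (U := [set y | indiff le (x + (h0 / 2 ^+ k) *: y) x]) hQ al1 mU).
    congr (P _); apply/seteqP; split => w'; rewrite /xsection /B /= inE /=; first by case.
    by move=> ?; split.
  - by move=> w /(_ Logic.I).
have mN : measurable (N (l, k)).
  have mXY : measurable_fun setT (fun w : Omega => (w : TT, Q w : borel_mx R n.+1)).
    by apply: measurable_fun_pair => //; exact: measurable_id_angle_space.
  by have := mXY measurableT B mB; rewrite setTI.
exists (N (l, k)); split => //; apply/eqP; rewrite eq_le measure_ge0 andbT.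
by move: PN; rewrite mul0e.
Qed.

End good_event.

(** * Termination, accuracy and the comparison count *)

Unset Implicit Arguments.
Set Strict Implicit.

(* The dimension is d = n.+1. *)
Theorem theorem3p11 (R : realType) (n : nat) (hd : (2 <= n.+1)%N)
    (le : rel 'rV[R]_n.+1) (le_complete : total le) (le_trans : transitive le)
    (C : set 'rV[R]_n.+1) (x nx : 'rV[R]_n.+1) (rx : \bar R)
    (hpf : plateau_free le C) (hpfx : plateau_free_at le x)
    (hrx : rx = regularity_radius le x nx) (hrx0 : (0 < rx)%E)
    (hreg : eregular_with le x rx nx)
    (hconv : convex_set (sublevel le x : set (convex_lmodType 'rV[R]_n.+1)))
    (eps : R) (heps0 : 0 < eps) (heps2 : eps <= Num.sqrt 2)
    (h0 : R) (hh0 : 0 < h0)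
    (disp : measure_display) (Omega : measurableType disp)
    (P : probability Omega R)
    (Q : {RV P >-> borel_mx R n.+1}) (theta : 'I_n -> {RV P >-> R})
    (hQ : haar_frame Q) (htheta : forall i, uniform_angle (theta i))
    (hind : independent_draws Q theta) :
  let run w := ane le x (steps n eps) (Q w : 'M[R]_n.+1)
                 (fun i => theta i w) h0 in
  {ae P, forall w, exists nhat h N,
     run w = Some (nhat, h, N) /\
     (ties_negligible le x h0 Q -> enorm (nhat - nx) <= eps)} /\
  (forall delta : R, 0 < delta < 1 ->
     exists2 A : set Omega, measurable A & ((1 - delta)%:E <= P A)%E /\
       forall w, A w -> exists nhat h N,
         run w = Some (nhat, h, N) /\
         N%:Z <= 2 * n%:Z * Num.ceil (log2 (7 * Num.sqrt n%:R / eps))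
                  + 2 * radius_term n.+1 h0 rx eps
                  + 16 + 4 * Num.ceil (log2 (1 / delta))).
Proof.
move=> run.
have n0 : (0 < n)%N by [].
have [T0 T2 _] := steps_bounds n0 heps0 heps2.
have [r1 r10 r1x] : exists2 r : R, 0 < r & (r%:E <= rx)%E.
  case: (rx) hrx0 => [r r0|_|//]; first by exists r.
  by exists 1 => //; rewrite leey.
have reg1 := hreg r1 (ltW r10) r1x.
have nx1 : dot nx nx = 1 by have [_ _ /enorm1] := reg1.
have outward u : 0 < dot u nx -> ~~ le (x + u) x.
  exact: (not_le_outward hconv r10 reg1).
have inward r u : 0 < r -> (r%:E <= rx)%E ->
    dot u u + 2 * r * dot u nx <= 0 -> le (x + u) x.
  by move=> r0 rrx; apply: le_inward; exact: hreg (ltW r0) rrx.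
have tpos (delta : R) : 0 < delta < 1 ->
    0 < eps * delta ^+ 2 / (256 * n.+1%:R ^+ 3).
  by move=> /andP[d0 _]; apply: threshold_gt0 => //; rewrite ltr0n.
have runP (delta : R) w : 0 < delta < 1 ->
    (forall i (m : nat), eps * delta ^+ 2 / (256 * n.+1%:R ^+ 3) <=
      `|planar_height Q theta le x nx (steps n eps) h0 i
          (m%:R * (pi / 2 ^+ (steps n eps).+1)) w|) ->
    exists nhat k N, [/\ run w = Some (nhat, h0 / 2 ^+ k, N),
      halved rx (eps * delta ^+ 2 / (256 * n.+1%:R ^+ 3)) h0 k,
      (N <= 2 * n * (steps n eps + 2) + 2 + 2 * k)%N
    & no_tie le x (steps n eps) (Q w : 'M[R]_n.+1) (fun i => theta i w) h0 ->
      enorm (nhat - nx) <= eps].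
  move=> d01 good.
  exact: (ane_spec le_complete outward inward hrx0 (tpos delta d01) nx1 T0 (hQ.1 w)
    hh0 good n0 heps0 (cos_pow_ge n0 heps0 heps2)).
split; last first.
  move=> delta d01.
  have [A mA [PA gA]] := good_event hind hQ htheta h0 le_complete hpfx nx1 n0 heps0 d01 T2.
  exists A => //; split => // w Aw.
  have [nhat [k [N [runE hk hN _]]]] := runP delta w d01 (gA w Aw).
  exists nhat, (h0 / 2 ^+ k), N; split => //.
  (* The 16 is 2 for the final line search plus twice the 7 of [halvings_bound], each halving
     costing two comparisons. *)
  have hk' := halvings_bound (ltn0Sn n) hrx0 hh0 heps0 d01 hk.
  have hT := comparisons_per_plane n0 heps0 heps2.
  move: hN hk' hT; clear; move: (steps n eps) => T.
  move: (radius_term _ _ _ _) (Num.ceil _) (Num.ceil _) => a b c.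
  nia.
(* The good events for [delta = 1 / m.+2] have a union of probability 1, and the run terminates on
   each of them. *)
have d01 (m : nat) : 0 < (m.+2%:R^-1 : R) < 1.
  by rewrite invr_gt0 ltr0n/= invf_lt1 ?ltr0n// ltr1n.
have termination : {ae P, forall w, exists m : nat,
    forall i (j : nat), eps * m.+2%:R^-1 ^+ 2 / (256 * n.+1%:R ^+ 3) <=
      `|planar_height Q theta le x nx (steps n eps) h0 i
          (j%:R * (pi / 2 ^+ (steps n eps).+1)) w|}.
  have /choice[A hA] (m : nat) : exists A : set Omega, measurable A /\
      ((1 - m.+2%:R^-1)%:E <= P A)%E /\ forall w, A w -> forall i (j : nat),
      eps * m.+2%:R^-1 ^+ 2 / (256 * n.+1%:R ^+ 3) <=
      `|planar_height Q theta le x nx (steps n eps) h0 i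
          (j%:R * (pi / 2 ^+ (steps n eps).+1)) w|.
    have [A mA hA] := good_event hind hQ htheta h0 le_complete hpfx nx1 n0 heps0 (d01 m) T2.
    by exists A.
  exists (~` \bigcup_m A m); split.
  - by apply: measurableC; apply: bigcup_measurable => m _; have [] := hA m.
  - apply/eqP; rewrite eq_le measure_ge0 andbT.
    have mU : measurable (\bigcup_m A m).
      by apply: bigcup_measurable => m _; have [] := hA m.
    rewrite probability_setC//.
    have Pfin : P (\bigcup_m A m) \is a fin_num by exact: fin_num_measure.
    rewrite -(fineK Pfin) -EFinB lee_fin subr_le0.
    rewrite leNgt; apply/negP => gap.
    have g0 : 0 < 1 - fine (P (\bigcup_m A m)) by rewrite subr_gt0.
    have gV : 0 <= (1 - fine (P (\bigcup_m A m)))^-1 by rewrite invr_ge0 ltW.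
    have := archi_boundP gV; set m := Num.bound _ => hm.
    have [mA [PA _]] := hA m.
    have : ((1 - m.+2%:R^-1)%:E <= (fine (P (\bigcup_m A m)))%:E)%E.
      rewrite fineK//; apply: Order.POrderTheory.le_trans PA _.
      by apply: le_measure; rewrite ?inE//; exact: bigcup_sup.
    rewrite lee_fin; apply/negP; rewrite -ltNge.
    have : (m.+2%:R : R)^-1 < 1 - fine (P (\bigcup_m A m)).
      rewrite -[ltRHS]invrK ltf_pV2 ?posrE ?invr_gt0 ?ltr0n//.
      by apply: lt_trans hm _; rewrite ltr_nat.
    by rewrite !ltrBrDr addrC.
  - move=> w /= nw [m _ Amw]; apply: nw; exists m.
    by have [_ [_ gA]] := hA m; exact: gA.
(* [ties_negligible] is a proposition about the law, not an event: when it fails, termination alone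
   is to be shown. *)
have [ties|noties] := pselect (ties_negligible le x h0 Q).
  have := no_tie_ae hind hQ (steps n eps) le_complete hpfx ties.
  apply: filterS2 termination => w [m good] notie.
  have [nhat [k [N [runE _ _ acc]]]] := runP _ w (d01 m) good.
  by exists nhat, (h0 / 2 ^+ k), N; split => // _; exact: acc.
apply: filterS termination => w [m good].
have [nhat [k [N [runE _ _ _]]]] := runP _ w (d01 m) good.
by exists nhat, (h0 / 2 ^+ k), N.
Qed.
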